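(* Let $q_1=a_1+v_1$, $q_2=a_2+v_2$ and $q_3=a_3+v_3$ be real quaternions with $a_1,a_2,a_3>1$. Then $$B_{q_1}*B_{q_2}=B_{q_3}$$ if and only if $q_3=q_1+q_2$ and the vectors $v_1,v_2$ are linearly dependent in $\mathbb{R}^3$.
   Context: $\mathbb{H}_{\mathbb R}$ is the real quaternion algebra with basis $1,e_1,e_2,e_3$, and $\mathbb{H}_{\mathbb C}$ its complexification (the complex unit $i$ commutes with $e_1,e_2,e_3$). In $q_j=a_j+v_j$, $a_j\in\mathbb{R}$ is the scalar part and $v_j$ the vector part (identified with a vector in $\mathbb{R}^3$). For $z\in\mathbb{C}$ and $q=a+v$, $z^q:=z^a[\cos(|v|\log z)+\frac{v}{|v|}\sin(|v|\log z)]\in\mathbb{H}_{\mathbb C}$ (principal branch $-\pi<\arg z\le\pi$; second term $0$ if $v=0$; $0^q:=0$ if $a>0$). For $a>1$ the quaternionic B-spline $B_q$ is defined by $\widehat{B_q}(\xi)=\left(\frac{1-e^{-i\xi}}{i\xi}\right)^q$ (base equal to $1$ at $\xi=0$), where $\widehat f(\xi)=\int_{\mathbb R}f(x)e^{-i\xi x}dx$. The convolution is $(f*g)(t)=\int_{\mathbb R}f(x)g(t-x)\,dx$, with $f(x)$ multiplying from the left, so $\widehat{f*g}=\widehat f\,\widehat g$. *)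

(* Defs.v *)
From HB Require Import structures.
From mathcomp Require Import all_boot all_order all_algebra.
From mathcomp Require Import complex ring.
From mathcomp Require Import all_classical all_reals all_analysis.
Set Implicit Arguments.
Unset Strict Implicit.
Unset Printing Implicit Defensive.
Import Order.TTheory GRing.Theory Num.Theory.
Import numFieldNormedType.Exports.
Local Open Scope classical_set_scope.
Local Open Scope ring_scope.
Local Open Scope complex_scope.

(* A quaternion q = a + v over K is the pair (a, v) of its scalar part and its
   vector part, v being the coordinate vector in the basis e1, e2, e3.  For
   K = R this is H_R; for K = R[i] it is H_C = C (x) H_R. *)
Definition quat (K : Type) := (K * 'rV[K]_3)%type.

Notation "'Sc' q" := (@fst _ _ q) (at level 10, q at level 8, only parsing).
Notation "'Ve' q" := (@snd _ _ q) (at level 10, q at level 8, only parsing).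

Section QuatRing.
Variable K : comNzRingType.
Implicit Types (u v w : 'rV[K]_3) (p q r : quat K).

HB.instance Definition _ := GRing.Lmodule.copy (quat K) (K^o * 'rV[K]_3)%type.

Definition dot3 v w : K := \sum_i v 0 i * w 0 i.

(* The indices i + 1 and i + 2 are taken modulo 3. *)
Definition cross3 v w : 'rV[K]_3 :=
  \row_i (v 0 (i + 1) * w 0 (i + 2) - v 0 (i + 2) * w 0 (i + 1)).

Definition qone : quat K := (1, 0).

(* Hamilton's product: (a + v)(b + w) = ab - v.w + a w + b v + v x w. *)
Definition qmul p q : quat K :=
  (Sc p * Sc q - dot3 (Ve p) (Ve q),
   Sc p *: Ve q + Sc q *: Ve p + cross3 (Ve p) (Ve q)).

Let ord3P (P : 'I_3 -> Prop) :
  P 0 -> P 1 -> P 2 -> forall i, P i.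
Proof.
by move=> P0 P1 P2 [[|[|[|//]]] hi];
   [move: P0|move: P1|move: P2]; congr P; apply/val_inj.
Qed.

Let i3E : ((((0%R : 'I_3) + 1)%R = 1%R) * (((0%R : 'I_3) + 2)%R = 2%R) *
  (((1%R : 'I_3) + 1)%R = 2%R) * (((1%R : 'I_3) + 2)%R = 0%R) *
  (((2%R : 'I_3) + 1)%R = 0%R) * (((2%R : 'I_3) + 2)%R = 1%R))%type.
Proof. by do !split; apply/val_inj. Qed.

Let dot3E v w : dot3 v w = v 0 0 * w 0 0 + v 0 1 * w 0 1 + v 0 2 * w 0 2.
Proof.
rewrite /dot3 !big_ord_recr big_ord0 /= add0r.
by congr (v 0 _ * w 0 _ + v 0 _ * w 0 _ + v 0 _ * w 0 _); apply/val_inj.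
Qed.

Fact qmulA : associative qmul.
Proof.
move=> p q r; congr pair => /=.
  by rewrite !dot3E !mxE !i3E; ring.
by apply/rowP; apply: ord3P; rewrite !mxE !i3E !dot3E; ring.
Qed.

Fact qmul1l : left_id qone qmul.
Proof.
move=> q; rewrite [RHS]surjective_pairing; congr pair => /=.
  by rewrite !dot3E !mxE; ring.
by apply/rowP; apply: ord3P; rewrite !mxE; ring.
Qed.

Fact qmul1r : right_id qone qmul.
Proof.
move=> q; rewrite [RHS]surjective_pairing; congr pair => /=.
  by rewrite !dot3E !mxE; ring.
by apply/rowP; apply: ord3P; rewrite !mxE; ring.
Qed.

Fact qmulDl : left_distributive qmul +%R.
Proof.
move=> p q r; congr pair => /=.
  by rewrite !dot3E !mxE; ring.
by apply/rowP; apply: ord3P; rewrite !mxE; ring.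
Qed.

Fact qmulDr : right_distributive qmul +%R.
Proof.
move=> p q r; congr pair => /=.
  by rewrite !dot3E !mxE; ring.
by apply/rowP; apply: ord3P; rewrite !mxE; ring.
Qed.

Fact qone_neq0 : qone != 0.
Proof. by apply/eqP => -[/eqP]; rewrite oner_eq0. Qed.

HB.instance Definition _ :=
  GRing.Zmodule_isNzRing.Build (quat K) qmulA qmul1l qmul1r qmulDl qmulDr qone_neq0.

End QuatRing.

Section ComplexFunctions.
Variable R : realType.
Implicit Types z w : R[i].

Definition cexp z : R[i] :=
  (expR (complex.Re z))%:C * (cos (complex.Im z) +i* sin (complex.Im z)).

Definition ccos z : R[i] := (cexp ('i * z) + cexp (- ('i * z))) / 2.

Definition csin z : R[i] := (cexp ('i * z) - cexp (- ('i * z))) / (2 * 'i).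

(* Principal argument, in ]-pi, pi]; negative reals have argument pi. *)
Definition carg z : R :=
  let t := acos (complex.Re z / ComplexField.Normc.normc z) in
  if 0 <= complex.Im z then t else - t.

Definition clog z : R[i] := ln (ComplexField.Normc.normc z) +i* carg z.

Definition cpowR z (a : R) : R[i] := cexp (a%:C * clog z).

(* Euclidean norm; the library's `|v| on matrices is the sup norm. *)
Definition enorm (v : 'rV[R]_3) : R := Num.sqrt (dot3 v v).

(* For v = 0 the vector part vanishes since x / 0 = 0.  The value 0 at z = 0 is
   only meaningful when Sc q > 0. *)
Definition qpow z (q : quat R) : quat R[i] :=
  if z == 0 then 0 else
  let w := (enorm (Ve q))%:C * clog z in
  cpowR z (Sc q) *:
    ((ccos w, (csin w / (enorm (Ve q))%:C) *: map_mx (real_complex R) (Ve q))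
     : quat R[i]).

End ComplexFunctions.

Section Fourier.
Variable R : realType.
Notation mu := (@lebesgue_measure R).
Implicit Types (f g : R -> quat R[i]).

Definition cintegrable (h : R -> R[i]) : Prop :=
  mu.-integrable setT (EFin \o (fun x => complex.Re (h x))) /\
  mu.-integrable setT (EFin \o (fun x => complex.Im (h x))).

Definition cint (h : R -> R[i]) : R[i] :=
  (\int[mu]_(x in setT) complex.Re (h x)) +i*
  (\int[mu]_(x in setT) complex.Im (h x)).

Definition qintegrable f : Prop :=
  cintegrable (fun x => Sc (f x)) /\
  forall k : 'I_3, cintegrable (fun x => (Ve (f x)) 0 k).

Definition qint f : quat R[i] :=
  (cint (fun x => Sc (f x)), \row_k cint (fun x => (Ve (f x)) 0 k)).

Definition fourier f (xi : R) : quat R[i] :=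
  qint (fun x => cexp (- ('i * (xi * x)%:C)) *: f x).

Definition qconv f g (t : R) : quat R[i] := qint (fun x => f x * g (t - x)).

Definition spline_base (xi : R) : R[i] :=
  if xi == 0 then 1 else (1 - cexp (- ('i * xi%:C))) / ('i * xi%:C).

(* The condition defines B_q as an element of L^1, that is up to equality
   almost everywhere. *)
Definition is_qBspline (q : quat R) (B : R -> quat R[i]) : Prop :=
  qintegrable B /\ forall xi : R, fourier B xi = qpow (spline_base xi) q.

End Fourier.

(* Main.v *)
(** The Fourier transform turns the convolution of quaternion-valued L^1
    functions into the Hamilton product and is injective on L^1 up to a.e.
    equality, so the claim is equivalent to [z^q1 z^q2 = z^q3] for all
    [z = (1 - e^(-i xi)) / (i xi)].

    If v1 and v2 lie on a common axis, the powers are exponentials along that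
    axis and multiply as such.  Conversely, at [xi = 2 y] with [0 < y < 2] we have
    [log z = L := ln (sin y / y) - i y].  The quaternion norm is multiplicative,
    which forces a3 = a1 + a2.  The imaginary part of the vector equation, divided
    by y, tends to v1 + v2 = v3 as y -> 0+.  The component of the vector equation
    along n = v1 x v2 is then [sin(|v1| L) sin(|v2| L) |n|^2 / (|v1| |v2|) = 0],
    and [sin(|v| L) <> 0] because L is not real, so n = 0.

    For injectivity, if all [int f(x) sin(xi x + c) dx] vanish, then so does
    [int f p(sin(eta x + c))] for every polynomial p.  The polynomials
    [(1 - s^n)^(n 2^n)] are bounded by 1 on [0, 1] and converge pointwise to the
    indicator of [s < 1/2]; dominated convergence, first in n and then in
    eta -> 0, gives [int_(a, oo) f = 0] for all a. *)

Require Import Defs.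
From mathcomp Require Import all_boot all_order all_algebra.
From mathcomp Require Import complex ring lra.
From mathcomp Require Import all_classical all_reals all_analysis.
From mathcomp Require Import measurable_realfun.
Set Implicit Arguments.
Unset Strict Implicit.
Unset Printing Implicit Defensive.
Import Order.TTheory GRing.Theory Num.Theory.
Import numFieldNormedType.Exports.
Local Open Scope classical_set_scope.
Local Open Scope ring_scope.
Local Open Scope complex_scope.

(** * Complex Lebesgue integrals and convolution *)

Lemma eq_complexP (R : rcfType) (z w : R[i]) : complex.Re z = complex.Re w ->
  complex.Im z = complex.Im w -> z = w.
Proof. by case: z w => [a b] [c d] /= -> ->. Qed.

(** * Translation invariance and the convolution kernel on the real line *)

Section RealIntegration.
Variable R : realType.
Notation mu := (@lebesgue_measure R).
Local Notation L1 f := (mu.-integrable setT (EFin \o f)).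
Implicit Types f g : R -> R.

(** By uniqueness of Lebesgue measure it suffices to compare lengths of the intervals []b, c]], and
    a shift does not change them. *)
Lemma lebesgue_measure_translation (a : R) (A : set R) : measurable A ->
  pushforward mu (fun x : measurableTypeR R => x - a : measurableTypeR R) A = mu A.
Proof.
move=> mA; have msub : measurable_fun setT (fun x : R => x - a).
  exact: measurable_funB.
apply/esym.
pose nu := pushforward mu (fun x : measurableTypeR R => x - a : measurableTypeR R).
apply: (lebesgue_measure_unique (mu := nu)) => //= _ [[b c]] _ <-.
rewrite /nu /pushforward.
have -> : (fun x : measurableTypeR R => x - a : measurableTypeR R) @^-1`
    [set` `]b, c]] = [set` `]b + a, c + a]] :> set R.
  by apply/seteqP; split => x /=; rewrite !in_itv/= ltrBrDr lerBlDr.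
by rewrite !lebesgue_measure_itv/= !lte_fin ltrD2r -!EFinB opprD addrACA subrr addr0.
Qed.

Lemma integrable_translation f (a : R) : L1 f ->
  L1 (fun x => f (x - a)).
Proof.
move=> intf.
have msub : measurable_fun setT (fun x : R => x - a) by exact: measurable_funB.
have mf : measurable_fun setT f.
  by apply/measurable_EFinP; exact: measurable_int intf.
apply/integrableP; split.
  by apply/measurable_EFinP; apply: (measurableT_comp mf).
have /integrableP[_] := intf; apply: le_lt_trans.
have := @ge0_integral_pushforward _ _ _ _ R
  (fun x : measurableTypeR R => x - a : measurableTypeR R) msub mu setT (abse \o EFin \o f).
rewrite preimage_setT => <-//; first last.
- by move=> y _ /=.
- have : measurable_fun setT ((abse \o EFin) \o f).
    by apply: measurableT_comp => //; exact/measurableT_comp.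
  exact.
rewrite le_eqVlt; apply/orP; left; apply/eqP.
by apply: eq_measure_integral => A mA _; exact: lebesgue_measure_translation.
Qed.

Lemma integral_translation f (a : R) : L1 f ->
  (\int[mu]_x (f (x - a))%:E = \int[mu]_x (f x)%:E)%E.
Proof.
move=> intf.
have msub : measurable_fun setT (fun x : R => x - a) by exact: measurable_funB.
have mf : measurable_fun setT f.
  by apply/measurable_EFinP; exact: measurable_int intf.
have := @integral_pushforward _ _ _ _ R
  (fun x : measurableTypeR R => x - a : measurableTypeR R) msub mu setT (EFin \o f).
rewrite preimage_setT => /(_ _ (integrable_translation a intf) measurableT) <-//.
  by apply: eq_measure_integral => A mA _; exact: lebesgue_measure_translation.
exact/measurable_EFinP.
Qed.

(** Tonelli's criterion: by translation invariance the integral of the absolute value over [z.1], at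
    fixed [z.2 = x], is [|f x|] times the L^1 norm of [g], so the total is the product of the two
    norms. The coordinate [z.1] is the argument of the convolution and [z.2] its integration
    variable. *)
Lemma integrable_conv_kernel f g : L1 f -> L1 g ->
  (mu \x mu)%E.-integrable setT (EFin \o (fun z : R * R => f z.2 * g (z.1 - z.2))).
Proof.
move=> intf intg.
have mf : measurable_fun setT f.
  by apply/measurable_EFinP; exact: measurable_int intf.
have mg : measurable_fun setT g.
  by apply/measurable_EFinP; exact: measurable_int intg.
pose K (z : R * R) := f z.2 * g (z.1 - z.2).
have mk : measurable_fun setT K.
  apply: measurable_funM; first exact: (measurableT_comp mf).
  by apply: (measurableT_comp mg); apply: measurable_funB.
apply/integrable21ltyP; first exact/measurable_EFinP.
have E (x : R) : (\int[mu]_y `|(EFin \o K) (y, x)|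
   = `|(f x)%:E| * \int[mu]_y `|(g y)%:E|)%E.
  have inormg : L1 (fun y => `|g y|%R) by exact: integrable_norm intg.
  have /= <- := integral_translation x inormg.
  rewrite -ge0_integralZl//=.
    by apply: eq_integral => y _; rewrite normrM EFinM.
  apply/measurable_EFinP; apply: measurableT_comp => //.
  by apply: (measurableT_comp mg); exact: measurable_funB.
under eq_integral do rewrite E.
rewrite ge0_integralZr//=; last first.
- exact: integral_ge0.
- by apply/measurable_EFinP; exact: measurableT_comp.
have /integrableP[_ hf] := intf; have /integrableP[_ hg] := intg.
by rewrite lte_mul_pinfty// ?integral_ge0// ge0_fin_numE ?integral_ge0.
Qed.

End RealIntegration.

(** * Complex-valued integrals, Fubini's theorem and scalar convolution *)

Section ComplexIntegration.
Variable R : realType.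
Notation mu := (@lebesgue_measure R).
Local Notation L1 f := (mu.-integrable setT (EFin \o f)).
Implicit Types (f g h : R -> R[i]) (K : R * R -> R[i]).

Lemma integrable_mul_le1 (u f : R -> R) : measurable_fun setT u ->
  (forall x, `|u x| <= 1) -> L1 f -> L1 (fun x => u x * f x).
Proof.
move=> um u1 iu.
suff bu : [bounded u x | x in [set: R]].
  have := @integrableMr _ (measurableTypeR R) R mu setT measurableT u _ um bu iu.
  by apply: eq_integrable.
exists 1; split; first exact: num_real.
by move=> M M1 x _ /=; rewrite (le_trans (u1 x))// ltW.
Qed.

Lemma integrable_scale (a : R) (f : R -> R) : L1 f -> L1 (fun x => a * f x).
Proof. by move=> /(integrableZl measurableT a); exact: eq_integrable. Qed.

Lemma integrable_cosM (xi : R) (f : R -> R) : L1 f ->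
  L1 (fun x => cos (xi * x) * f x).
Proof.
apply: integrable_mul_le1 => [|x]; last exact: cos_max.
apply: continuous_measurable_fun => x; apply: continuous_comp.
  exact: mulrl_continuous.
exact: continuous_cos.
Qed.

Lemma integrable_sinM (xi : R) (f : R -> R) : L1 f ->
  L1 (fun x => sin (xi * x) * f x).
Proof.
apply: integrable_mul_le1 => [|x]; last exact: sin_max.
apply: continuous_measurable_fun => x; apply: continuous_comp.
  exact: mulrl_continuous.
exact: continuous_sin.
Qed.

Lemma ae_imp (P Q : R -> Prop) : (forall x, P x -> Q x) ->
  {ae mu, forall x, P x} -> {ae mu, forall x, Q x}.
Proof.
by have FF := ae_filter_ringOfSetsType mu; move=> PQ; exact: filterS.
Qed.

Lemma ae_and (P Q : R -> Prop) : {ae mu, forall x, P x} ->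
  {ae mu, forall x, Q x} -> {ae mu, forall x, P x /\ Q x}.
Proof.
by have FF := ae_filter_ringOfSetsType mu; apply: filterS2.
Qed.

Lemma eq_cintegrable f g : f =1 g -> cintegrable f -> cintegrable g.
Proof. by move=> /funext->. Qed.

Lemma cintegrableD f g : cintegrable f -> cintegrable g ->
  cintegrable (fun x => f x + g x).
Proof.
move=> [fr fi] [gr gi]; split.
  apply: eq_integrable (integrableD measurableT fr gr) => // x _ /=.
  by case: (f x) (g x) => [? ?] [].
apply: eq_integrable (integrableD measurableT fi gi) => // x _ /=.
by case: (f x) (g x) => [? ?] [].
Qed.

Lemma cintegrableN f : cintegrable f -> cintegrable (fun x => - f x).
Proof.
move=> [fr fi]; split.
  apply: eq_integrable (integrableN fr) => // x _ /=.
  by case: (f x).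
apply: eq_integrable (integrableN fi) => // x _ /=.
by case: (f x).
Qed.

Lemma cintegrableB f g : cintegrable f -> cintegrable g ->
  cintegrable (fun x => f x - g x).
Proof. by move=> cf /cintegrableN; exact: cintegrableD. Qed.

Lemma eq_cint f g : f =1 g -> cint f = cint g.
Proof. by move=> /funext ->. Qed.

Lemma cintD f g : cintegrable f -> cintegrable g ->
  cint (fun x => f x + g x) = cint f + cint g.
Proof.
move=> [fr fi] [gr gi]; rewrite /cint; apply: eq_complexP => /=.
  rewrite -RintegralD//; apply: eq_Rintegral => x _.
  by case: (f x) (g x) => [? ?] [].
rewrite -RintegralD//; apply: eq_Rintegral => x _.
by case: (f x) (g x) => [? ?] [].
Qed.

Lemma cintZ (c : R[i]) f : cintegrable f ->
  cint (fun x => c * f x) = c * cint f.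
Proof.
case: c => a b [fr fi]; rewrite /cint; apply: eq_complexP => /=.
  rewrite -RintegralZl// -RintegralZl// -RintegralB//; last 2 first.
  - exact: integrable_scale.
  - exact: integrable_scale.
  by apply: eq_Rintegral => x _; case: (f x).
rewrite -RintegralZl// -RintegralZl// -RintegralD//; last 2 first.
- exact: integrable_scale.
- exact: integrable_scale.
by apply: eq_Rintegral => x _; case: (f x).
Qed.

Lemma cintN f : cintegrable f -> cint (fun x => - f x) = - cint f.
Proof.
by move=> cf; rewrite -mulN1r -cintZ//; apply: eq_cint => x; rewrite mulN1r.
Qed.

Lemma cintB f g : cintegrable f -> cintegrable g ->
  cint (fun x => f x - g x) = cint f - cint g.
Proof. by move=> cf cg; rewrite cintD ?cintN//; exact: cintegrableN. Qed.

Lemma ae_eq_cint f g : cintegrable f -> cintegrable g ->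
  {ae mu, forall x, f x = g x} -> cint f = cint g.
Proof.
move=> [fr fi] [gr gi] fg; rewrite /cint; apply: eq_complexP => /=; congr fine.
  apply: ae_eq_integral => //; try exact: measurable_int fr.
    exact: measurable_int gr.
  by apply: ae_imp fg => x /= ->.
apply: ae_eq_integral => //; try exact: measurable_int fi.
  exact: measurable_int gi.
by apply: ae_imp fg => x /= ->.
Qed.

Lemma cint_translation f (a : R) : cintegrable f ->
  cintegrable (fun x => f (x - a)) /\ cint (fun x => f (x - a)) = cint f.
Proof.
move=> [fr fi]; split.
  split; [exact: (integrable_translation a fr)|
          exact: (integrable_translation a fi)].
rewrite /cint; apply: eq_complexP => /=; congr fine.
  exact: (integral_translation a fr).
exact: (integral_translation a fi).
Qed.

Definition cintegrable2 K : Prop :=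
  (mu \x mu)%E.-integrable setT (EFin \o (fun z => complex.Re (K z))) /\
  (mu \x mu)%E.-integrable setT (EFin \o (fun z => complex.Im (K z))).

Lemma cintegrable2_conv f g : cintegrable f -> cintegrable g ->
  cintegrable2 (fun z => f z.2 * g (z.1 - z.2)).
Proof.
move=> [fr fi] [gr gi]; split.
  have := integrableB measurableT (integrable_conv_kernel fr gr)
    (integrable_conv_kernel fi gi).
  apply: eq_integrable => // z _ /=.
  by case: (f _) (g _) => [? ?] [].
have := integrableD measurableT (integrable_conv_kernel fr gi)
    (integrable_conv_kernel fi gr).
apply: eq_integrable => // z _ /=.
by case: (f _) (g _) => [? ?] [? ?] /=; rewrite -EFinD addrC.
Qed.

Lemma ae_cintegrable2 K : cintegrable2 K ->
  {ae mu, forall t, cintegrable (fun x => K (t, x))}.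
Proof.
move=> [/ae_integrable1 Kr /ae_integrable1 Ki].
exact: ae_and Kr Ki.
Qed.

(** Fubini's theorem concerns extended real inner integrals. Almost every section is integrable, and
    there [fine] loses nothing; [finF] and [finG] carry the theorem over to real-valued inner
    integrals. *)
Lemma Rintegral_fubini (k : R * R -> R) : (mu \x mu)%E.-integrable setT (EFin \o k) ->
  L1 (fun t => \int[mu]_x k (t, x)) /\
  \int[mu]_t \int[mu]_x k (t, x) = \int[mu]_x \int[mu]_t k (t, x).
Proof.
move=> ik; have iF := integrable_fubini_F ik; have Fub := Fubini ik.
have finF : {ae mu, forall t,
    (\int[mu]_x (k (t, x))%:E)%E = (\int[mu]_x k (t, x))%:E}.
  apply: ae_imp (ae_integrable1 ik) => t it.
  by rewrite /Rintegral fineK//; exact: integrable_fin_num.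
have finG : {ae mu, forall x,
    (\int[mu]_t (k (t, x))%:E)%E = (\int[mu]_t k (t, x))%:E}.
  apply: ae_imp (ae_integrable2 ik) => t it.
  by rewrite /Rintegral fineK//; exact: integrable_fin_num.
have mF : measurable_fun setT (fun t => \int[mu]_x k (t, x)).
  exact: measurableT_comp (measurable_int _ iF).
have mG : measurable_fun setT (fun x => \int[mu]_t k (t, x)).
  have := measurable_fubini_G ik.
  exact: measurableT_comp.
split.
  apply/integrableP; split; first exact/measurable_EFinP.
  have /integrableP[_] := iF; apply: le_lt_trans.
  rewrite le_eqVlt; apply/orP; left; apply/eqP.
  apply: ae_eq_integral => //.
  - by do 2 apply: measurableT_comp => //.
  - by apply: measurableT_comp => //; exact: measurable_int iF.
  - apply: ae_imp finF => t tF _.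
    change (abse (\int[mu]_x k (t, x))%:E = abse (\int[mu]_x (k (t, x))%:E))%E.
    by rewrite tF.
congr fine; transitivity (\int[mu]_t \int[mu]_x (k (t, x))%:E)%E.
  apply: ae_eq_integral => //.
  - exact/measurable_EFinP.
  - exact: measurable_int iF.
  - by apply: ae_imp finF => t tF _; exact/esym.
rewrite [LHS]Fub; apply: ae_eq_integral => //.
- exact: measurable_fubini_G ik.
- exact/measurable_EFinP.
- by apply: ae_imp finG => t tG _.
Qed.

Lemma cint_fubini K : cintegrable2 K ->
  cintegrable (fun t => cint (fun x => K (t, x))) /\
  cint (fun t => cint (fun x => K (t, x))) =
  cint (fun x => cint (fun t => K (t, x))).
Proof.
move=> [/Rintegral_fubini[Kr1 Kr2] /Rintegral_fubini[Ki1 Ki2]]; split.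
  by split.
by rewrite /cint; apply: eq_complexP => /=.
Qed.

Definition cphase (xi x : R) : R[i] := cexp (- ('i * (xi * x)%:C)).

Lemma cphaseE xi x : cphase xi x = cos (xi * x) -i* sin (xi * x).
Proof.
rewrite /cphase /cexp /=; apply: eq_complexP => /=.
  by rewrite !(mul0r,mul1r,subr0,mulr0,add0r,oppr0,expR0,cosN).
by rewrite !(mul0r,mul1r,subr0,mulr0,add0r,addr0,oppr0,expR0,sinN).
Qed.

Lemma cphaseD xi x y : cphase xi (x + y) = cphase xi x * cphase xi y.
Proof.
rewrite !cphaseE; apply: eq_complexP => /=; rewrite mulrDr ?cosD ?sinD; ring.
Qed.

Lemma cintegrable_phase f xi : cintegrable f ->
  cintegrable (fun x => cphase xi x * f x).
Proof.
move=> [fr fi].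
split.
  have := integrableD measurableT (integrable_cosM xi fr)
    (integrable_sinM xi fi).
  apply: eq_integrable => // x _ /=; rewrite cphaseE.
  by case: (f x) => ? ? /=; rewrite mulNr opprK.
have := integrableB measurableT (integrable_cosM xi fi)
  (integrable_sinM xi fr).
apply: eq_integrable => // x _ /=; rewrite cphaseE.
by case: (f x) => ? ? /=; rewrite mulNr -EFinB.
Qed.

Definition cfourier f (xi : R) : R[i] := cint (fun x => cphase xi x * f x).

Definition cconv f g (t : R) : R[i] := cint (fun x => f x * g (t - x)).

Lemma cintegrable_cconv f g : cintegrable f -> cintegrable g ->
  cintegrable (cconv f g).
Proof.
by move=> cf cg; have [] := cint_fubini (cintegrable2_conv cf cg).
Qed.

Lemma ae_cintegrable_cconv f g : cintegrable f -> cintegrable g ->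
  {ae mu, forall t, cintegrable (fun x => f x * g (t - x))}.
Proof.
by move=> cf cg; exact: (ae_cintegrable2 (cintegrable2_conv cf cg)).
Qed.

(** After exchanging the integrals, the inner one is [f x] times the integral of a translate of
    [g]. *)
Lemma cint_cconv f g : cintegrable f -> cintegrable g ->
  cint (cconv f g) = cint f * cint g.
Proof.
move=> cf cg; have [_ ->] := cint_fubini (cintegrable2_conv cf cg).
rewrite [RHS]mulrC -cintZ//; apply: eq_cint => x /=.
have [cgx <-] := cint_translation x cg.
by rewrite cintZ// mulrC.
Qed.

(** The phase is a character: with [t = (t - x) + x] it distributes over the two factors. Hence the
    phase times the convolution is the convolution of the two functions multiplied by the phase, and
    [cint_cconv] applies. The identity holds at those [t] where the section is integrable, hence
    almost everywhere. *)
Theorem cfourier_cconv f g xi : cintegrable f -> cintegrable g ->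
  cfourier (cconv f g) xi = cfourier f xi * cfourier g xi.
Proof.
move=> cf cg.
have cpf := cintegrable_phase xi cf; have cpg := cintegrable_phase xi cg.
rewrite /cfourier -cint_cconv//; apply: ae_eq_cint.
- exact/cintegrable_phase/cintegrable_cconv.
- exact: cintegrable_cconv.
apply: ae_imp (ae_cintegrable_cconv cf cg) => t it /=.
rewrite /cconv -cintZ//; apply: eq_cint => x.
by rewrite -{1}(subrK x t) (cphaseD xi (t - x) x) /=; ring.
Qed.

End ComplexIntegration.

(** * Injectivity of the Fourier transform *)

Section StepApprox.
Variable R : realType.
Implicit Types (s t x h : R) (n m : nat).

Lemma bernoulli_ge h n : 0 <= h -> 1 + n%:R * h <= (1 + h) ^+ n.
Proof.
move=> h0; elim: n => [|n IH]; first by rewrite mul0r addr0 expr0.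
rewrite exprS -natr1 mulrDl mul1r.
have : 0 <= n%:R * h :> R by rewrite mulr_ge0.
nra.
Qed.

Lemma bernoulli_le h n : 0 <= h <= 1 -> 1 - n%:R * h <= (1 - h) ^+ n.
Proof.
move=> /andP[h0 h1]; elim: n => [|n IH]; first by rewrite mul0r subr0 expr0.
rewrite exprS -natr1 mulrDl mul1r.
have : 0 <= n%:R * h :> R by rewrite mulr_ge0.
nra.
Qed.

(** The exponent is chosen so that its product with [s ^+ n] is [n (2 s)^n], which tends to 0 for
    [s < 1/2] and is at least [n] for [s >= 1/2]. *)
Definition step_approx n s : R := (1 - s ^+ n) ^+ (n * 2 ^ n).

Lemma step_approx_01 n s : 0 <= s <= 1 -> 0 <= step_approx n s <= 1.
Proof.
move=> /andP[s0 s1]; have sn0 := exprn_ge0 n s0.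
have sn1 : s ^+ n <= 1 by rewrite exprn_ile1.
by rewrite exprn_ge0 ?subr_ge0//= exprn_ile1 ?subr_ge0// gerBl.
Qed.

(** Bernoulli's inequality for [t^-1 = 1 + h] gives [n h <= t^-n], where [h = (1 - t) / t]. *)
Lemma geometric_linear_bound t n : 0 < t < 1 -> n%:R * t ^+ n <= t / (1 - t).
Proof.
move=> /andP[t0 t1].
have h0 : 0 <= t^-1 - 1 by rewrite subr_ge0 invf_ge1// ltW.
have := bernoulli_ge n h0; rewrite addrCA subrr addr0 exprVn => H.
have tn0 : 0 < t ^+ n by rewrite exprn_gt0.
have : (1 + n%:R * (t^-1 - 1)) * t ^+ n <= 1.
  by rewrite -ler_pdivlMr// mul1r.
have tt : t * t^-1 = 1 by rewrite divff// gt_eqF.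
rewrite ler_pdivlMr ?subr_gt0// => H2.
have -> : n%:R * t ^+ n * (1 - t) = t * (n%:R * (t^-1 - 1) * t ^+ n).
  transitivity (n%:R * t ^+ n * (t * t^-1 - t)); first by rewrite tt.
  by ring.
by rewrite -[leRHS]mulr1 ler_pM2l//; nra.
Qed.

(** With [r = t^2] the sequence is [(n t^n) t^n], a bounded factor times a null sequence. *)
Lemma cvg_geometric_linear r : 0 <= r < 1 ->
  (fun n => n%:R * r ^+ n : R) @ \oo --> (0 : R).
Proof.
move=> /andP[]; rewrite le_eqVlt => /predU1P[<- _|r0 r1].
  rewrite -(cvg_shiftn 1); apply: cvg_near_cst; apply: nearW => n /=.
  by rewrite addn1 expr0n mulr0.
set t := Num.sqrt r.
have t0 : 0 < t by rewrite sqrtr_gt0.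
have t1 : t < 1 by rewrite -sqrtr1 ltr_sqrt.
have tr : r = t ^+ 2 by rewrite sqr_sqrtr// ltW.
have t01 : 0 < t < 1 by rewrite t0.
apply: (@squeeze_cvgr _ _ _ _ (cst 0) (fun n => t / (1 - t) * t ^+ n)).
- apply: nearW => n /=; apply/andP; split.
    by rewrite mulr_ge0// exprn_ge0// ltW.
  rewrite tr -exprM mulnC exprM expr2 mulrA.
  by rewrite ler_wpM2r ?geometric_linear_bound ?exprn_ge0 ?ltW.
- exact: cvg_cst.
- rewrite -[X in _ --> X](mulr0 (t / (1 - t))).
  apply: cvgMr; apply: cvg_expr.
  by rewrite ger0_norm// ltW.
Qed.

(** Bernoulli's inequality bounds the sequence below by [1 - n (2 s)^n]. *)
Lemma step_approx_lt s : 0 <= s -> s < 2^-1 ->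
  step_approx ^~ s @ \oo --> (1 : R).
Proof.
move=> s0 s12; have s1 : s <= 1 by lra.
have s01 : 0 <= s <= 1 by rewrite s0.
apply: (@squeeze_cvgr _ _ _ _ (fun n => 1 - n%:R * (2 * s) ^+ n) (cst 1)).
- apply: nearW => n /=; have /andP[_ ->] := step_approx_01 n s01.
  rewrite andbT; apply: le_trans (bernoulli_le _ _).
    by rewrite natrM natrX exprMn mulrA.
  by rewrite exprn_ge0// exprn_ile1.
- rewrite -[X in _ --> X](subr0 1); apply: cvgB; first exact: cvg_cst.
  by apply: cvg_geometric_linear; lra.
- exact: cvg_cst.
Qed.

(** Multiplied by [(1 + s^n)^(n 2^n)], the sequence becomes [(1 - s^(2n))^(n 2^n) <= 1], while
    Bernoulli's inequality makes this multiplier at least [1 + n (2 s)^n >= 1 + n]. *)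
Lemma step_approx_ge s : 2^-1 <= s -> s <= 1 ->
  step_approx ^~ s @ \oo --> (0 : R).
Proof.
move=> s12 s1; have s0 : 0 <= s by lra.
have s01 : 0 <= s <= 1 by rewrite s0.
apply: (@squeeze_cvgr _ _ _ _ (cst 0) (fun n => n.+1%:R^-1)).
- apply: nearW => n; have /andP[-> _] := step_approx_01 n s01.
  have sn0 := exprn_ge0 n s0.
  have sn1 : s ^+ n <= 1 by rewrite exprn_ile1.
  rewrite /= -[leRHS]mul1r ler_pdivlMr//.
  apply: (@le_trans _ _ (step_approx n s * (1 + s ^+ n) ^+ (n * 2 ^ n))).
    apply: ler_wpM2l; first by have /andP[] := step_approx_01 n s01.
    apply: le_trans (bernoulli_ge _ sn0).
    rewrite -nat1r lerD2l natrM -mulrA natrX -exprMn.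
    by rewrite -[leLHS]mulr1 ler_wpM2l// exprn_ege1//; lra.
  rewrite -exprMn exprn_ile1//; nra.
- exact: cvg_cst.
- exact: cvg_harmonic.
Qed.

End StepApprox.

(** * Integrable functions whose trigonometric moments vanish *)

Section ZeroMoments.
Variable R : realType.
Notation mu := (@lebesgue_measure R).
Local Notation L1 f := (mu.-integrable setT (EFin \o f)).
Implicit Types (f g u : R -> R).

(** The free phase [c] covers cosines and, at [xi = 0], constants; this makes the class stable under
    multiplication by sines. *)
Definition zero_moments f : Prop :=
  L1 f /\ forall xi c : R, \int[mu]_x (sin (xi * x + c) * f x) = 0.

Lemma measurable_sin_affine (xi c : R) :
  measurable_fun setT (fun x : R => sin (xi * x + c)).
Proof.
apply: continuous_measurable_fun => x; apply: continuous_comp.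
  by apply: cvgD; [exact: mulrl_continuous | exact: cvg_cst].
exact: continuous_sin.
Qed.

Lemma integrable_sin_affineM f (xi c : R) : L1 f -> L1 (fun x => sin (xi * x + c) * f x).
Proof.
apply: integrable_mul_le1; first exact: measurable_sin_affine.
by move=> x; exact: sin_max.
Qed.

Lemma zero_moments_int f : zero_moments f -> \int[mu]_x f x = 0.
Proof.
move=> [_ /(_ 0 (pi / 2))] <-; apply: eq_Rintegral => x _.
by rewrite mul0r add0r sin_pihalf mul1r.
Qed.

Lemma zero_moments_comb f g (a b : R) : zero_moments f -> zero_moments g ->
  zero_moments (fun x => a * f x + b * g x).
Proof.
move=> [f1 f0] [g1 g0].
split.
  have := integrableD measurableT (integrable_scale a f1) (integrable_scale b g1).
  exact: eq_integrable.
move=> xi c; transitivity (\int[mu]_x (a * (sin (xi * x + c) * f x) +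
    b * (sin (xi * x + c) * g x))).
  by apply: eq_Rintegral => x _; ring.
rewrite RintegralD ?RintegralZl//.
- by rewrite f0 g0 !mulr0 addr0.
- exact: integrable_sin_affineM.
- exact: integrable_sin_affineM.
- exact/integrable_scale/integrable_sin_affineM.
- exact/integrable_scale/integrable_sin_affineM.
Qed.

Lemma zero_moments_ext f g : f =1 g -> zero_moments f -> zero_moments g.
Proof. by move=> /funext ->. Qed.

(** Product-to-sum: [2 sin y sin z = cos (y - z) - cos (y + z)], each cosine being a sine shifted by
    [pi / 2]. *)
Lemma zero_moments_sin f (eta d : R) : zero_moments f ->
  zero_moments (fun x => sin (eta * x + d) * f x).
Proof.
move=> [f1 f0]; split; first exact: integrable_sin_affineM.
move=> xi c; transitivity (\int[mu]_x (2^-1 *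
    (sin ((xi - eta) * x + (c - d + pi / 2)) * f x) +
    (- 2^-1) * (sin ((xi + eta) * x + (c + d + pi / 2)) * f x))).
  apply: eq_Rintegral => x _.
  have sE y : sin (y + pi / 2) = cos y :> R by rewrite sinDpihalf.
  have -> : (xi - eta) * x + (c - d + pi / 2) =
    ((xi * x + c) - (eta * x + d)) + pi / 2 by ring.
  have -> : (xi + eta) * x + (c + d + pi / 2) =
    ((xi * x + c) + (eta * x + d)) + pi / 2 by ring.
  rewrite !sE; move: (xi * x + c) (eta * x + d) => y z.
  by rewrite cosB cosD; field.
rewrite RintegralD ?RintegralZl//.
- by rewrite !f0 !mulr0 addr0.
- exact: integrable_sin_affineM.
- exact: integrable_sin_affineM.
- exact/integrable_scale/integrable_sin_affineM.
- exact/integrable_scale/integrable_sin_affineM.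
Qed.

(** Stability under [s], then under its powers, then under [1 - s^n] and its powers: only sums and
    products with sines are involved. *)
Lemma zero_moments_step_approx f (eta d : R) n : zero_moments f ->
  zero_moments (fun x => step_approx n ((1 + sin (eta * x + d)) / 2) * f x).
Proof.
pose s (x : R) : R := (1 + sin (eta * x + d)) / 2.
have S f' : zero_moments f' -> zero_moments (fun x => s x * f' x).
  move=> f0; have := zero_moments_comb 2^-1 2^-1 f0 (zero_moments_sin eta d f0).
  by apply: zero_moments_ext => x; rewrite /s; field.
have Sn k f' : zero_moments f' -> zero_moments (fun x => s x ^+ k * f' x).
  elim: k => [|k IH] f0.
    by apply: zero_moments_ext f0 => x; rewrite expr0 mul1r.
  by apply: zero_moments_ext (S _ (IH f0)) => x; rewrite exprS mulrA.
have Tn f' : zero_moments f' -> zero_moments (fun x => (1 - s x ^+ n) * f' x).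
  move=> f0; have := zero_moments_comb 1 (- 1) f0 (Sn n _ f0).
  by apply: zero_moments_ext => x; ring.
rewrite /step_approx; elim: (n * 2 ^ n)%N => [|k IH] f0.
  by apply: zero_moments_ext f0 => x; rewrite expr0 mul1r.
by apply: zero_moments_ext (Tn _ (IH f0)) => x; rewrite exprS mulrA.
Qed.

(** Dominated convergence with majorant [|f|]; every passage to the limit in the uniqueness argument
    goes through it. *)
Lemma Rintegral_bounded_limit f (u_ : nat -> R -> R) u : L1 f ->
  (forall n, measurable_fun setT (u_ n)) -> (forall n x, `|u_ n x| <= 1) ->
  (forall x, u_ ^~ x @ \oo --> u x) ->
  (forall n, \int[mu]_x (u_ n x * f x) = 0) ->
  \int[mu]_x (u x * f x) = 0.
Proof.
move=> f1 mu_ u1 uu u0.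
have mf : measurable_fun setT f.
  by apply/measurable_EFinP; exact: measurable_int f1.
have mu' : measurable_fun setT u.
  apply: (@measurable_fun_cvg _ _ _ setT u_) => // x _; exact: uu.
have mfn n : measurable_fun setT (fun x => (u_ n x * f x)%:E).
  exact/measurable_EFinP/measurable_funM.
have mfl : measurable_fun setT (fun x => (u x * f x)%:E).
  exact/measurable_EFinP/measurable_funM.
have cvgf : {ae mu, forall x, setT x ->
    (fun n => (u_ n x * f x)%:E) @ \oo --> (u x * f x)%:E}.
  apply: aeW => x _; apply: cvg_EFin; first exact: nearW.
  by apply: cvgM; [exact: uu|exact: cvg_cst].
have bdf : {ae mu, forall x n, setT x -> (`|(u_ n x * f x)%:E| <= `|f x|%:E)%E}.
  by apply: aeW => x n _ /=; rewrite lee_fin normrM ler_piMl.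
have [_ _] := @dominated_convergence _ (measurableTypeR R) R mu setT measurableT
  _ _ _ mfn mfl cvgf (integrable_norm f1) bdf.
have -> : (fun n => \int[mu]_x (u_ n x * f x)%:E)%E = cst 0%E.
  apply/funext => n.
  rewrite -[LHS]fineK; last first.
    by apply: integrable_fin_num => //; exact: integrable_mul_le1.
  by congr EFin; exact: u0.
by move=> /(cvg_unique (@ereal_hausdorff R) (cvg_cst _)) H; rewrite /Rintegral -H.
Qed.

End ZeroMoments.

(** * From vanishing moments to vanishing almost everywhere *)

Section Uniqueness.
Variable R : realType.
Notation mu := (@lebesgue_measure R).
Local Notation L1 f := (mu.-integrable setT (EFin \o f)).
Implicit Types (f g u : R -> R).

Lemma sin_itv (x : R) : -1 <= sin x <= 1.
Proof. by rewrite sin_geN1 sin_le1. Qed.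

Lemma zero_moments_sin_gt0 f (eta d : R) : zero_moments f ->
  \int[mu]_x ((0 < sin (eta * x + d))%R%:R * f x) = 0.
Proof.
move=> f0; have f1 := f0.1.
(* The shift by [pi] flips the sign of the sine, so that [s x < 1/2] exactly when
   [sin (eta * x + d) > 0]. *)
pose s (x : R) : R := (1 + sin (eta * x + (d + pi))) / 2.
have sE x : s x = (1 - sin (eta * x + d)) / 2 by rewrite /s addrA sinDpi.
have s01 x : 0 <= s x <= 1 by have := sin_itv (eta * x + d); rewrite sE; lra.
apply: (Rintegral_bounded_limit (u_ := fun n x => step_approx n (s x))) => //.
- move=> n; apply: measurable_funX; apply: measurable_funB => //.
  apply: measurable_funX; apply: measurable_funM => //.
  by apply: measurable_funD => //; exact: measurable_sin_affine.
- move=> n x; have /andP[h0 h1] := step_approx_01 n (s01 x).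
  by rewrite ger0_norm.
- move=> x; have /andP[h0 h1] := s01 x; case: ltP => h.
    by apply: step_approx_lt => //; move: h; rewrite sE; lra.
  by apply: step_approx_ge => //; move: h; rewrite sE; lra.
- by move=> n; apply/zero_moments_int/zero_moments_step_approx.
Qed.

(** For [eta = 1 / (n + 1)], once [|x - a| < n + 1] the argument [eta (x - a)] lies in []-1, 1[],
    where the sine has the sign of [x - a]. *)
Lemma zero_moments_ray f (a : R) : zero_moments f ->
  \int[mu]_x ((a < x)%R%:R * f x) = 0.
Proof.
move=> f0; have f1 := f0.1.
pose u_ (n : nat) (x : R) : R := (0 < sin (n.+1%:R^-1 * x + - (n.+1%:R^-1 * a)))%R%:R.
apply: (Rintegral_bounded_limit (u_ := u_)) => //.
- move=> n; rewrite (_ : u_ n = fun x =>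
      if 0 < sin (n.+1%:R^-1 * x + - (n.+1%:R^-1 * a)) then 1 else 0); last first.
    by apply/funext => x; rewrite /u_; case: ifP.
  apply: measurable_fun_ifT => //; apply: measurable_fun_ltr => //.
  exact: measurable_sin_affine.
- by move=> n x; rewrite /u_; case: (_ < _); rewrite ?normr1 ?normr0.
- move=> x; apply: cvg_near_cst; near=> n.
  have xn : `|x - a| < n.+1%:R.
    apply: (@lt_trans _ _ n%:R); last by rewrite ltr_nat.
    by near: n; exact: nbhs_infty_gtr.
  rewrite /u_ -mulrBr; congr (nat_of_bool _)%:R.
  have n0 : 0 < n.+1%:R^-1 :> R by rewrite invr_gt0.
  have t1 : `|n.+1%:R^-1 * (x - a)| < 1.
    by rewrite normrM gtr0_norm// mulrC ltr_pdivrMr// mul1r.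
  case: (ltP a x) => [ax|xa].
    rewrite sin2_gt0// mulr_gt0 ?subr_gt0//=.
    by rewrite (le_lt_trans (ler_norm _))// (lt_trans t1)// ltr1n.
  suff sin_le0 : sin (n.+1%:R^-1 * (x - a)) <= 0 by rewrite ltNge sin_le0.
  rewrite -oppr_ge0 -sinN.
  move: xa; rewrite le_eqVlt => /predU1P[->|xa].
    by rewrite subrr mulr0 oppr0 sin0.
  apply/ltW/sin2_gt0; rewrite oppr_gt0 pmulr_rlt0// subr_lt0 xa/=.
  by rewrite (le_lt_trans (ler_norm _))// normrN (lt_trans t1)// ltr1n.
- by move=> n; apply: zero_moments_sin_gt0.
Unshelve. all: by end_near. Qed.

Lemma measurable_indic_fun (A : set R) : measurable A ->
  measurable_fun setT (fun x : R => \1_A x : R).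
Proof. by move=> mA; have /measurable_indicP := mA; apply. Qed.

(** A pi-lambda argument: the open rays are closed under intersection and generate the Borel sets,
    and the sets over which [f] integrates to 0 form a lambda-system. *)
Lemma zero_moments_measurable f (E : set R) : zero_moments f -> measurable E ->
  \int[mu]_x (\1_E x * f x) = 0.
Proof.
move=> f0; have f1 := f0.1.
pose H := [set A : set R | measurable A /\ \int[mu]_x (\1_A x * f x) = 0].
suff HE : @measurable _ (measurableTypeR R) `<=` H by move=> /HE[].
have mE : @measurable _ (measurableTypeR R) = <<s (@RGenOInfty.G R) >>.
  exact: RGenOInfty.measurableE.
rewrite mE; apply: lambda_system_subset => //.
- move=> A B [a ->] [b ->]; exists (Num.max a b).
  by apply/seteqP; split => x /=; rewrite !in_itv/= !andbT gt_max => /andP.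
- have fD (A B : set R) : B `<=` A -> forall x, \1_(A `\` B) x = \1_A x - \1_B x :> R.
    move=> BA x; rewrite !indicE in_setD.
    have [xB|xB] := boolP (x \in B).
      by rewrite (mem_set (BA _ (set_mem xB))) /= subrr.
    by rewrite andbT subr0.
  have L1i (A : set R) : measurable A -> L1 (fun x => \1_A x * f x).
    move=> mA; apply: integrable_mul_le1 => //.
    by move=> x; rewrite indicE; case: (_ \in _); rewrite ?normr1 ?normr0.
  split => //.
  + split => //; rewrite -[RHS](zero_moments_int f0).
    by apply: eq_Rintegral => x _; rewrite indicT mul1r.
  + move=> A B BA [mA A0] [mB B0]; split; first exact: measurableD.
    transitivity (\int[mu]_x (\1_A x * f x - \1_B x * f x)).
      by apply: eq_Rintegral => x _; rewrite fD// mulrBl.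
    by rewrite RintegralB ?A0 ?B0 ?subrr//; exact: L1i.
  + move=> F ndF HF; split.
      by apply: bigcupT_measurable => n; have [] := HF n.
    apply: (Rintegral_bounded_limit (u_ := fun n => \1_(F n))) => //.
    * by move=> n; apply: measurable_indic_fun; have [] := HF n.
    * by move=> n x; rewrite indicE; case: (_ \in _); rewrite ?normr1 ?normr0.
    * move=> x; rewrite [in X in _ --> X]indicE.
      have [/set_mem[N _ FNx]|xF] := boolP (x \in \bigcup_n F n).
        apply: cvg_near_cst; exists N => // n /= Nn.
        rewrite indicE mem_set//; move/subsetPset: (ndF _ _ Nn); exact.
      apply: cvg_near_cst; apply: nearW => n; rewrite indicE memNset// => Fnx.
      by move: xF => /negP; apply; apply/mem_set; exists n.
    * by move=> n; have [] := HF n.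
- move=> A [a ->]; split; first exact: measurable_itv.
  rewrite -[RHS](zero_moments_ray a f0); apply: eq_Rintegral => x _.
  rewrite indicE; congr ((nat_of_bool _)%:R * _); apply/idP/idP.
    by move=> /set_mem /=; rewrite in_itv/= andbT.
  by move=> ax; apply/mem_set; rewrite /= in_itv/= andbT.
Qed.

Lemma zero_moments_ae0 f : zero_moments f -> {ae mu, forall x, f x = 0}.
Proof.
move=> f0; have f1 := f0.1.
have : ae_eq mu setT (EFin \o f) (cst 0%E).
  apply: integral_ae_eq => // E _ mE.
  rewrite integral0 integral_mkcond/=.
  have := zero_moments_measurable f0 mE.
  rewrite /Rintegral => H.
  transitivity (\int[mu]_x (\1_E x * f x)%:E)%E.
    apply: eq_integral => x _; rewrite patchE indicE.
    by case: ifPn => _; rewrite ?mul1r ?mul0r.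
  rewrite -[LHS]fineK ?H//.
  apply: integrable_fin_num => //.
  apply: integrable_mul_le1 => //.
  by move=> x; rewrite indicE; case: (_ \in _); rewrite ?normr1 ?normr0.
by apply: ae_imp => x /(_ Logic.I) [].
Qed.

(** Each equation at [xi] mixes moments of the real and imaginary parts of [h]. Cosine is even and
    sine odd, so adding and subtracting the equations at [xi] and [- xi] separates them, and both
    parts have zero moments. *)
Theorem cfourier_inj (h : R -> R[i]) : cintegrable h ->
  (forall xi, cfourier h xi = 0) -> {ae mu, forall x, h x = 0}.
Proof.
move=> [hr hi] h0.
pose hR x := complex.Re (h x); pose hI x := complex.Im (h x).
have eqR xi : \int[mu]_x (cos (xi * x) * hR x) +
              \int[mu]_x (sin (xi * x) * hI x) = 0.
  have /(congr1 (@complex.Re R)) /= <- := h0 xi.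
  rewrite -RintegralD//; [|exact: integrable_cosM|exact: integrable_sinM].
  apply: eq_Rintegral => x _; rewrite cphaseE /hR /hI.
  by case: (h x) => ? ? /=; rewrite mulNr opprK.
have eqI xi : \int[mu]_x (cos (xi * x) * hI x) -
              \int[mu]_x (sin (xi * x) * hR x) = 0.
  have /(congr1 (@complex.Im R)) /= <- := h0 xi.
  rewrite -RintegralB//; [|exact: integrable_cosM|exact: integrable_sinM].
  apply: eq_Rintegral => x _; rewrite cphaseE /hR /hI.
  by case: (h x) => ? ? /=; rewrite mulNr.
have cN xi (g : R -> R) : \int[mu]_x (cos (- xi * x) * g x) =
    \int[mu]_x (cos (xi * x) * g x).
  by apply: eq_Rintegral => x _; rewrite mulNr cosN.
have sN xi (g : R -> R) : L1 g -> \int[mu]_x (sin (- xi * x) * g x) =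
    - \int[mu]_x (sin (xi * x) * g x).
  move=> g1; rewrite -[RHS]mulN1r -RintegralZl//; last exact: integrable_sinM.
  by apply: eq_Rintegral => x _; rewrite mulNr sinN mulN1r mulNr.
have zm (g : R -> R) : L1 g -> (forall xi, \int[mu]_x (cos (xi * x) * g x) = 0) ->
    (forall xi, \int[mu]_x (sin (xi * x) * g x) = 0) -> zero_moments g.
  move=> g1 gc gs; split => // xi c.
  transitivity (\int[mu]_x (cos c * (sin (xi * x) * g x) +
                            sin c * (cos (xi * x) * g x))).
    by apply: eq_Rintegral => x _; rewrite sinD; ring.
  rewrite RintegralD ?RintegralZl ?gc ?gs ?mulr0 ?addr0//.
  - exact: integrable_cosM.
  - exact: integrable_sinM.
  - exact/integrable_scale/integrable_sinM.
  - exact/integrable_scale/integrable_cosM.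
have zR : zero_moments hR.
  apply: zm => // xi.
    by have := eqR xi; have := eqR (- xi); rewrite cN sN//; lra.
  by have := eqI xi; have := eqI (- xi); rewrite cN sN//; lra.
have zI : zero_moments hI.
  apply: zm => // xi.
    by have := eqI xi; have := eqI (- xi); rewrite cN sN//; lra.
  by have := eqR xi; have := eqR (- xi); rewrite cN sN//; lra.
apply: ae_imp (ae_and (zero_moments_ae0 zR) (zero_moments_ae0 zI)) => x [].
by rewrite /hR /hI; case: (h x) => /= ? ? -> ->.
Qed.

End Uniqueness.

(** * Quaternionic powers *)

Section Vectors.
Variable K : comNzRingType.
Implicit Types (u v w : 'rV[K]_3) (p q : quat K).

Lemma ord3P (P : 'I_3 -> Prop) : P 0 -> P 1 -> P 2 -> forall i, P i.
Proof.
by move=> P0 P1 P2 [[|[|[|//]]] hi];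
   [move: P0|move: P1|move: P2]; congr P; apply/val_inj.
Qed.

Lemma ord3E : ((((0%R : 'I_3) + 1)%R = 1%R) * (((0%R : 'I_3) + 2)%R = 2%R) *
  (((1%R : 'I_3) + 1)%R = 2%R) * (((1%R : 'I_3) + 2)%R = 0%R) *
  (((2%R : 'I_3) + 1)%R = 0%R) * (((2%R : 'I_3) + 2)%R = 1%R))%type.
Proof. by do !split; apply/val_inj. Qed.

Lemma dot3E v w : dot3 v w = v 0 0 * w 0 0 + v 0 1 * w 0 1 + v 0 2 * w 0 2.
Proof.
rewrite /dot3 !big_ord_recr big_ord0 /= add0r.
by congr (v 0 _ * w 0 _ + v 0 _ * w 0 _ + v 0 _ * w 0 _); apply/val_inj.
Qed.

Lemma dot3Zl (k : K) v w : dot3 (k *: v) w = k * dot3 v w.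
Proof. by rewrite !dot3E !mxE; ring. Qed.

Lemma dot3C v w : dot3 v w = dot3 w v.
Proof. by rewrite !dot3E; ring. Qed.

Lemma cross3vv v : cross3 v v = 0.
Proof. by apply/rowP => i; rewrite !mxE mulrC subrr. Qed.

Lemma cross3Z (k l : K) v w : cross3 (k *: v) (l *: w) = (k * l) *: cross3 v w.
Proof. by apply/rowP => i; rewrite !mxE; ring. Qed.

(** No conjugation of coefficients: over [R[i]] this form is complex-valued and not definite, but it
    is multiplicative, by Euler's four-square identity. *)
Definition qnorm q : K := q.1 ^+ 2 + dot3 q.2 q.2.

Lemma qmulE p q : p * q = (p.1 * q.1 - dot3 p.2 q.2,
  p.1 *: q.2 + q.1 *: p.2 + cross3 p.2 q.2).
Proof. by []. Qed.

Lemma qnormM p q : qnorm (p * q) = qnorm p * qnorm q.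
Proof.
rewrite qmulE /qnorm /= !dot3E !mxE !ord3E; ring.
Qed.

Lemma qnormZ (k : K) q : qnorm (k *: q) = k ^+ 2 * qnorm q.
Proof. by rewrite /qnorm /= !dot3E !mxE; rewrite /GRing.scale /=; ring. Qed.

Lemma qscaleM (k l : K) p q : (k *: p) * (l *: q) = (k * l) *: (p * q).
Proof.
rewrite !qmulE; congr pair; rewrite /= ?dot3E.
  by rewrite !mxE /GRing.scale /=; ring.
by apply/rowP; apply: ord3P; rewrite !mxE !ord3E /GRing.scale /=; ring.
Qed.

End Vectors.

Section Dependence.
Variable F : fieldType.
Implicit Types (v w : 'rV[F]_3).

Lemma free2N v w : ~~ free [:: v; w] = (w == 0) || (v \in <[w]>%VS).
Proof. by rewrite free_cons seq1_free span_seq1 negb_and !negbK orbC. Qed.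

(** The components of the cross product are the 2 by 2 minors of the pair; when they vanish, [v] is
    [v_i / w_i] times [w] for any [i] with [w_i <> 0]. *)
Lemma cross3_eq0_dep v w : cross3 v w = 0 -> ~~ free [:: v; w].
Proof.
move=> vw0; rewrite free2N; have [//|/= w0] := eqVneq w 0.
have vw (i j : 'I_3) : v 0 i * w 0 j = v 0 j * w 0 i.
  have c k : v 0 (k + 1) * w 0 (k + 2) = v 0 (k + 2) * w 0 (k + 1).
    by have /rowP /(_ k) := vw0; rewrite !mxE => /eqP; rewrite subr_eq0 => /eqP.
  have := (c 0, c 1, c 2); rewrite !ord3E => -[[c0 c1] c2].
  by move: i j; apply: ord3P; apply: ord3P => //; rewrite ?c0 ?c1 ?c2.
have [i wi0] : exists i, w 0 i != 0.
  by move/rV0Pn: w0.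
apply/vlineP; exists (v 0 i / w 0 i); apply/rowP => j; rewrite !mxE.
by rewrite mulrAC vw mulfK.
Qed.

End Dependence.

(** * Complex sine and cosine *)

Section ComplexTrig.
Variable R : realType.
Implicit Types (z w : R[i]) (x y : R).

Lemma cexpD z w : cexp (z + w) = cexp z * cexp w.
Proof.
by case: z w => [a b] [c d]; apply: eq_complexP; rewrite /= expRD ?cosD ?sinD; ring.
Qed.

Lemma cexp0 : cexp 0 = 1 :> R[i].
Proof. by rewrite /cexp /= expR0 cos0 sin0 mul1r. Qed.

Lemma cexp_neq0 z : cexp z != 0.
Proof.
apply/eqP => e0; have : cexp (z - z) = 1 by rewrite subrr cexp0.
by rewrite cexpD e0 mul0r => /esym/eqP; rewrite oner_eq0.
Qed.

Lemma complexi_neq0 : 'i != 0 :> R[i].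
Proof. by rewrite eq_complex /= oner_eq0 andbF. Qed.

Lemma sqr_complexi : 'i * 'i = - 1 :> R[i].
Proof. by apply: eq_complexP => /=; ring. Qed.

Lemma ccosD z w : ccos (z + w) = ccos z * ccos w - csin z * csin w.
Proof.
rewrite /ccos /csin mulrDr opprD !cexpD.
have i0 := complexi_neq0; have ii := sqr_complexi.
set a := cexp _; set b := cexp _; set c := cexp _; set d := cexp _.
(* The product ['i * 'i] is isolated because [field] treats ['i] as an atom and cannot use that its
   square is -1. *)
have -> : (a - c) / (2 * 'i) * ((b - d) / (2 * 'i)) =
  (a - c) * (b - d) / (4 * ('i * 'i)) by field.
by rewrite ii; field.
Qed.

Lemma csinD z w : csin (z + w) = csin z * ccos w + ccos z * csin w.
Proof.
rewrite /ccos /csin mulrDr opprD !cexpD.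
by have i0 := complexi_neq0; field.
Qed.

Lemma ccos0 : ccos 0 = 1 :> R[i].
Proof. by rewrite /ccos mulr0 oppr0 cexp0; field. Qed.

Lemma csin0 : csin 0 = 0 :> R[i].
Proof. by rewrite /csin mulr0 oppr0 subrr mul0r. Qed.

Lemma ccosN z : ccos (- z) = ccos z.
Proof. by rewrite /ccos mulrN opprK addrC. Qed.

Lemma csinN z : csin (- z) = - csin z.
Proof. by rewrite /csin mulrN opprK -[RHS]mulNr opprB. Qed.

Lemma ccos2Dsin2 z : ccos z ^+ 2 + csin z ^+ 2 = 1.
Proof.
by rewrite -ccos0 -(subrr z) ccosD ccosN csinN; ring.
Qed.

Definition rcosh x : R := (expR x + expR (- x)) / 2.
Definition rsinh x : R := (expR x - expR (- x)) / 2.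

Lemma ccosE x y : ccos (x +i* y) =
  (cos x * rcosh y) -i* (sin x * rsinh y).
Proof.
rewrite /ccos /cexp /rcosh /rsinh.
have -> : 2^-1 = (real_complex R 2^-1) by rewrite fmorphV rmorph_nat.
apply: eq_complexP => /=;
  rewrite !(mul0r, mul1r, add0r, sub0r, addr0, opprK, cosN, sinN); by field.
Qed.

Lemma csinE x y : csin (x +i* y) =
  (sin x * rcosh y) +i* (cos x * rsinh y).
Proof.
rewrite /csin invfM.
have -> : 2^-1 = (real_complex R 2^-1) by rewrite fmorphV rmorph_nat.
have -> : 'i^-1 = - 'i :> R[i].
  by apply: (mulfI complexi_neq0); rewrite divff ?complexi_neq0// mulrN sqr_complexi opprK.
rewrite /cexp /rcosh /rsinh.
apply: eq_complexP => /=;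
  rewrite !(mul0r, mul1r, add0r, sub0r, addr0, opprK, cosN, sinN); by field.
Qed.

End ComplexTrig.

(** * Powers along an axis, and the logarithm of the base *)

Section Powers.
Variable R : realType.
Implicit Types (z L : R[i]) (y a : R) (u v w : 'rV[R]_3) (q : quat R).
Notation cvec v := (map_mx (real_complex R) v).

Lemma dot3_ge0 v : 0 <= dot3 v v.
Proof. by rewrite dot3E !addr_ge0 // -expr2 sqr_ge0. Qed.

Lemma dot3_eq0 v : dot3 v v = 0 -> v = 0.
Proof.
rewrite dot3E -!expr2 => v0; apply/rowP => i; rewrite !mxE.
apply/eqP; rewrite -sqrf_eq0; apply/eqP; move: i; apply: ord3P;
have := sqr_ge0 (v 0 0); have := sqr_ge0 (v 0 1); have := sqr_ge0 (v 0 2); lra.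
Qed.

Lemma sqr_enorm v : enorm v ^+ 2 = dot3 v v.
Proof. by rewrite sqr_sqrtr// dot3_ge0. Qed.

Lemma enorm_eq0 v : (enorm v == 0) = (v == 0).
Proof.
apply/eqP/eqP => [e0|->]; last by rewrite /enorm dot3E !mxE !mulr0 !addr0 sqrtr0.
by apply: dot3_eq0; rewrite -sqr_enorm e0 expr0n.
Qed.

Lemma enorm_scale_unit (s : R) u : dot3 u u = 1 -> enorm (s *: u) = `|s|.
Proof.
by move=> u1; rewrite /enorm dot3Zl dot3C dot3Zl u1 mulr1 -expr2 sqrtr_sqr.
Qed.

Lemma dot3_cvec u v : dot3 (cvec u) (cvec v) = (dot3 u v)%:C.
Proof.
by rewrite !dot3E !mxE -!(rmorphM (real_complex R)) -!(rmorphD (real_complex R)).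
Qed.

Lemma cross3_cvec u v : cross3 (cvec u) (cvec v) = cvec (cross3 u v).
Proof.
by apply/rowP => i; rewrite !mxE -!(rmorphM (real_complex R)) -(rmorphB (real_complex R)).
Qed.

(** The power [e^(a L) (cos (s L) + u sin (s L))] in terms of a unit axis [u] and a signed
    coordinate [s]: no division by a norm, and no special case at [s = 0]. *)
Definition qexp_axis u L (a s : R) : quat R[i] :=
  cexp (a%:C * L) *: ((ccos (s%:C * L), csin (s%:C * L) *: cvec u) : quat R[i]).

(** Reversing the sign of [s] is harmless since cosine is even and sine odd; at [s = 0] the sine
    vanishes on both sides. *)
Lemma qpow_axis z a (s : R) u : z != 0 -> dot3 u u = 1 ->
  qpow z (a, s *: u) = qexp_axis u (clog z) a s.
Proof.
move=> z0 u1; rewrite /qpow (negbTE z0) /qexp_axis /cpowR /=; congr (_ *: (_, _)).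
  rewrite enorm_scale_unit//; have [s0|s0] := leP 0 s; first by rewrite ger0_norm.
  by rewrite ltr0_norm// rmorphN mulNr ccosN.
rewrite enorm_scale_unit// map_mxZ /= scalerA; congr (_ *: _).
have [s0|s0|s0] := ltgtP 0 s.
- by rewrite gtr0_norm// divfK// fmorph_eq0 gt_eqF.
- by rewrite ltr0_norm// rmorphN mulNr csinN invrN mulrNN divfK// fmorph_eq0 lt_eqF.
- by rewrite -s0 normr0 !mul0r csin0 !mul0r.
Qed.

(** As [u * u = -1], products along the axis follow the addition formulas for cosine and sine. *)
Lemma qexp_axisM u L a1 a2 (s1 s2 : R) : dot3 u u = 1 ->
  qexp_axis u L a1 s1 * qexp_axis u L a2 s2 = qexp_axis u L (a1 + a2) (s1 + s2).
Proof.
move=> u1; rewrite /qexp_axis qscaleM -cexpD -mulrDl -(rmorphD (real_complex R)).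
congr (_ *: _); rewrite qmulE /= dot3Zl dot3C dot3Zl dot3_cvec u1.
rewrite rmorphD mulrDl ccosD csinD cross3Z cross3vv scaler0 addr0 mulr1.
by rewrite !scalerA -scalerDl; congr (_, _ *: _); ring.
Qed.

Lemma common_axis v w : ~~ free [:: v; w] ->
  exists u (s t : R), [/\ dot3 u u = 1, v = s *: u & w = t *: u].
Proof.
have unit_axis (x : 'rV[R]_3) : x != 0 -> exists2 u, dot3 u u = 1 & x = enorm x *: u.
  move=> x0; have e0 : enorm x != 0 by rewrite enorm_eq0.
  exists ((enorm x)^-1 *: x); last by rewrite scalerA divff// scale1r.
  by rewrite dot3Zl dot3C dot3Zl -sqr_enorm; field.
rewrite free2N; have [-> _|w0 /= /vlineP[k ->]] := eqVneq w 0.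
  have [->|v0] := eqVneq v 0.
    (* Both vectors vanish, so any unit vector serves as axis. *)
    exists (delta_mx 0 0), 0, 0; rewrite !scale0r; split => //.
    by rewrite dot3E !mxE /= !mulr1 !mul0r !addr0.
  have [u u1 vu] := unit_axis v v0.
  by exists u, (enorm v), 0; rewrite scale0r.
have [u u1 wu] := unit_axis w w0.
by exists u, (k * enorm w), (enorm w); rewrite -scalerA -wu.
Qed.

Lemma qpowM z q1 q2 : ~~ free [:: q1.2; q2.2] ->
  qpow z q1 * qpow z q2 = qpow z (q1 + q2).
Proof.
case: q1 q2 => [a1 v1] [a2 v2] /= /common_axis[u [s [t [u1 -> ->]]]].
(* The base of the spline does vanish, at the nonzero multiples of [2 pi]; there both sides are
   0. *)
have [->|z0] := eqVneq z 0; first by rewrite /qpow eqxx mul0r.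
have -> : (a1, s *: u) + (a2, t *: u) = (a1 + a2, (s + t) *: u) :> quat R.
  by rewrite scalerDl.
by rewrite !qpow_axis// qexp_axisM.
Qed.

(** Since [cos^2 + sin^2 = 1] also for complex arguments, the norm forgets the vector part of the
    exponent. *)
Lemma qnorm_qpow z q : z != 0 -> qnorm (qpow z q) = cexp (q.1%:C * clog z) ^+ 2.
Proof.
move=> z0; rewrite /qpow (negbTE z0) qnormZ; rewrite -[RHS]mulr1; congr (_ * _).
rewrite /qnorm /= dot3Zl dot3C dot3Zl dot3_cvec.
have [v0|v0] := eqVneq q.2 0.
  rewrite v0 (_ : enorm 0 = 0); last by apply/eqP; rewrite enorm_eq0.
  by rewrite mul0r ccos0 csin0 !mul0r addr0 expr1n.
rewrite -[RHS](ccos2Dsin2 ((enorm q.2)%:C * clog z)); congr (_ + _).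
rewrite -sqr_enorm rmorphXn.
have e0 : (enorm q.2)%:C != 0 by rewrite fmorph_eq0 enorm_eq0.
by field.
Qed.

(** This is [1 - e^(-2iy) = 2i sin y e^(-iy)]; the argument [2 * y] avoids half-angles. *)
Lemma spline_base2 y : 0 < y < 2 ->
  spline_base (2 * y) = (sin y / y)%:C * (cos y -i* sin y).
Proof.
move=> /andP[y0 y1]; rewrite /spline_base mulf_eq0 pnatr_eq0 (gt_eqF y0) /=.
have e0 : 'i * (2 * y)%:C != 0.
  by rewrite mulf_neq0 ?complexi_neq0// fmorph_eq0 mulf_neq0// gt_eqF.
apply: (mulIf e0); rewrite divfK//; apply: eq_complexP => /=.
  rewrite !(mul0r, mul1r, subr0, add0r, mulr0, oppr0, expR0, sub0r, cosN, addr0).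
  have -> : 2 * y = y + y by ring.
  rewrite cosD; have := cos2Dsin2 y.
  have -> : - (sin y / y * - sin y * (y + y)) = 2 * sin y ^+ 2.
    by field; rewrite gt_eqF.
  by move=> cs; rewrite -[X in X - _]cs; ring.
rewrite !(mul0r, mul1r, subr0, add0r, mulr0, oppr0, expR0, sub0r, sinN, addr0, opprK).
have -> : 2 * y = y + y by ring.
by rewrite sinD; field; rewrite gt_eqF.
Qed.

Lemma clog_spline_base y : 0 < y < 2 ->
  spline_base (2 * y) != 0 /\ clog (spline_base (2 * y)) = ln (sin y / y) -i* y.
Proof.
move=> y01; have /andP[y0 y1] := y01; rewrite spline_base2//.
have r0 : 0 < sin y / y by rewrite divr_gt0// sin2_gt0.
have sy : 0 < sin y by rewrite sin2_gt0.
set r := sin y / y in r0 *.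
have zE : r%:C * (cos y -i* sin y) = (r * cos y) -i* (r * sin y).
  by apply: eq_complexP => /=; ring.
rewrite zE; split.
  apply/eqP => -[_ /eqP]; rewrite oppr_eq0 mulf_eq0 (gt_eqF r0) (gt_eqF sy).
  by [].
have nE : ComplexField.Normc.normc ((r * cos y) -i* (r * sin y)) = r.
  rewrite /ComplexField.Normc.normc sqrrN !exprMn -mulrDr cos2Dsin2 mulr1.
  by rewrite -exprMn sqrtr_sqr gtr0_norm.
(* The imaginary part is negative, so [carg] is [- acos (cos y)], which is [- y] because
   [y < 2 <= pi]. *)
rewrite /clog nE /carg nE /= leNgt oppr_lt0 mulr_gt0//=; congr (_ +i* - _).
rewrite mulrAC divff ?gt_eqF// mul1r cosK// in_itv/= ltW//=.
by rewrite (le_trans (ltW y1))// pi_ge2.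
Qed.

End Powers.

(** * Powers of the base of the spline *)

Section Limits.
Variable R : realType.
Implicit Types (c y : R).

Lemma derive_quotient_at_right (f : R -> R) (d : R) :
  is_derive (0 : R) 1 f d -> (f y - f 0) / y @[y --> 0^'+] --> d.
Proof.
move=> [df <-]; apply: cvg_dnbhs_at_right.
have -> : (fun y => (f y - f 0) / y) =
    (fun h => h^-1 *: ((f \o shift 0) (h *: 1) - f 0)).
  by apply/funext => h; rewrite /= addr0 /GRing.scale /= mulr1 mulrC.
exact: df.
Qed.

Lemma cvg_sinc : sin y / y @[y --> (0 : R)^'+] --> (1 : R).
Proof.
have := derive_quotient_at_right (is_derive_sin (0 : R)).
by rewrite cos0 sin0; under eq_fun do rewrite subr0.
Qed.

(** For [0 < y < 2], the logarithm of the modulus of the base at [2 * y]. *)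
Definition logsinc y : R := ln (sin y / y).

Lemma cvg_logsinc : logsinc y @[y --> (0 : R)^'+] --> (0 : R).
Proof.
rewrite -[X in _ --> X](@ln1 R).
by apply: continuous_cvg; [apply: continuous_ln; exact: ltr01 | exact: cvg_sinc].
Qed.

Lemma cvg_expR_quotient c : (expR (c * y) - 1) / y @[y --> (0 : R)^'+] --> c.
Proof.
have dE : is_derive (0 : R) 1 (expR \o (fun y : R => c * y)) c.
  have dl : is_derive (0 : R) 1 (fun y : R => c * y) c.
    have := @is_deriveZ R R^o R^o id c (0 : R) 1 1 _.
    rewrite /GRing.scale /= mulr1; exact.
  have := @is_derive1_comp R expR (fun y : R => c * y) 0 1 c.
  rewrite mul1r; apply => //.
  by have := is_derive_expR (c * 0); rewrite {2}mulr0 expR0.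
have := derive_quotient_at_right dE.
by rewrite /= mulr0 expR0.
Qed.

(** Half the difference of the difference quotients of [expR (- c * y)] and [expR (c * y)] at 0. *)
Lemma cvg_rsinh_quotient c : rsinh (- (c * y)) / y @[y --> (0 : R)^'+] --> - c.
Proof.
have -> : (fun y => rsinh (- (c * y)) / y) = (fun y =>
    ((expR (- c * y) - 1) / y - (expR (c * y) - 1) / y) / 2).
  by apply/funext => y; rewrite /rsinh opprK mulNr; ring.
rewrite [X in _ --> X](_ : - c = (- c - c) / 2); last by field.
by apply: cvgMl; apply: cvgB; exact: cvg_expR_quotient.
Qed.

Lemma cvg_rcosh c : rcosh (- (c * y)) @[y --> (0 : R)^'+] --> (1 : R).
Proof.
have cl (k : R) : expR (k * y) @[y --> (0 : R)^'+] --> (1 : R).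
  rewrite -(@expR0 R); apply: continuous_cvg; first exact: continuous_expR.
  apply: cvg_at_right_filter.
  have := @mulrl_continuous R k 0; rewrite /continuous_at mulr0; exact.
have -> : (fun y => rcosh (- (c * y))) = (fun y => (expR (- c * y) + expR (c * y)) / 2).
  by apply/funext => y; rewrite /rcosh opprK mulNr.
rewrite -[X in _ --> X](_ : (1 + 1) / 2 = 1 :> R); last by field.
by apply: cvgMl; apply: cvgD; exact: cl.
Qed.

Lemma cvg_logsincM c : c * logsinc y @[y --> (0 : R)^'+] --> (0 : R).
Proof. by rewrite -[X in _ --> X](mulr0 c); apply: cvgMr; exact: cvg_logsinc. Qed.

Lemma cvg_cos_logsinc c : cos (c * logsinc y) @[y --> (0 : R)^'+] --> (1 : R).
Proof.
rewrite -(@cos0 R); apply: continuous_cvg; first exact: continuous_cos.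
exact: cvg_logsincM.
Qed.

Lemma cvg_sin_logsinc c : sin (c * logsinc y) @[y --> (0 : R)^'+] --> (0 : R).
Proof.
rewrite -[X in _ --> X](@sin0 R); apply: continuous_cvg; first exact: continuous_sin.
exact: cvg_logsincM.
Qed.

End Limits.

(** * Consequences of multiplicativity of the powers of the base *)

Section Forward.
Variable R : realType.
Implicit Types (c y : R) (v : 'rV[R]_3) (q : quat R).

(** The principal logarithm of the base at [2 * y], for [0 < y < 2]. *)
Definition slog y : R[i] := logsinc y -i* y.

(** [qcos] and [qsin] are the scalar part and the coefficient of [v] in the power, up to the factor
    from the scalar exponent. At [v = 0] the division makes [qsin] equal to 0, which is harmless as
    it multiplies [v]. *)
Definition qcos v y : R[i] := ccos ((enorm v)%:C * slog y).
Definition qsin v y : R[i] := csin ((enorm v)%:C * slog y) / (enorm v)%:C.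

Lemma slog_scale c y : c%:C * slog y = (c * logsinc y) +i* (- (c * y)).
Proof. by apply: eq_complexP => /=; ring. Qed.

Lemma cvg_qcos_re v : complex.Re (qcos v y) @[y --> (0 : R)^'+] --> (1 : R).
Proof.
have -> : (fun y => complex.Re (qcos v y)) = (fun y =>
    cos (enorm v * logsinc y) * rcosh (- (enorm v * y))).
  by apply/funext => y; rewrite /qcos slog_scale ccosE.
rewrite -[X in _ --> X](mulr1 1).
by apply: cvgM; [exact: cvg_cos_logsinc | exact: cvg_rcosh].
Qed.

Lemma cvg_qcos_im v : complex.Im (qcos v y) / y @[y --> (0 : R)^'+] --> (0 : R).
Proof.
have -> : (fun y => complex.Im (qcos v y) / y) = (fun y =>
    - (sin (enorm v * logsinc y) * (rsinh (- (enorm v * y)) / y))).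
  by apply/funext => y; rewrite /qcos slog_scale ccosE /= mulNr mulrA.
rewrite -[X in _ --> X](_ : - (0 * - enorm v) = 0); last by rewrite mul0r oppr0.
apply: cvgN.
by apply: cvgM; [exact: cvg_sin_logsinc | exact: cvg_rsinh_quotient].
Qed.

Lemma divcC (z : R[i]) c : z / c%:C = (complex.Re z / c) +i* (complex.Im z / c).
Proof.
by rewrite -(fmorphV (real_complex R)); apply: eq_complexP; case: z => a b /=; ring.
Qed.

Lemma cvg_qsin_re v : complex.Re (qsin v y) @[y --> (0 : R)^'+] --> (0 : R).
Proof.
have -> : (fun y => complex.Re (qsin v y)) = (fun y =>
    sin (enorm v * logsinc y) * rcosh (- (enorm v * y)) / enorm v).
  by apply/funext => y; rewrite /qsin divcC slog_scale csinE.
rewrite -[X in _ --> X](_ : 0 * 1 / enorm v = 0); last by rewrite !mul0r.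
apply: cvgMl.
by apply: cvgM; [exact: cvg_sin_logsinc | exact: cvg_rcosh].
Qed.

(** The unsimplified quotient in the limit is 1 for [v <> 0] and 0 for [v = 0], so one statement
    serves both cases; [enorm_divZ] removes it in front of [v]. *)
Lemma cvg_qsin_im v : complex.Im (qsin v y) / y @[y --> (0 : R)^'+] -->
  - (enorm v / enorm v).
Proof.
have -> : (fun y => complex.Im (qsin v y) / y) = (fun y =>
    cos (enorm v * logsinc y) * (rsinh (- (enorm v * y)) / y) / enorm v).
  by apply/funext => y; rewrite /qsin divcC slog_scale csinE /= mulrAC mulrA.
rewrite -[X in _ --> X](_ : 1 * - enorm v / enorm v = _); last by rewrite mul1r mulNr.
apply: cvgMl.
by apply: cvgM; [exact: cvg_cos_logsinc | exact: cvg_rsinh_quotient].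
Qed.

Lemma cvg_imM (z w : R -> R[i]) (a b c d : R) :
  complex.Re (z y) @[y --> (0 : R)^'+] --> a ->
  complex.Im (z y) / y @[y --> (0 : R)^'+] --> b ->
  complex.Re (w y) @[y --> (0 : R)^'+] --> c ->
  complex.Im (w y) / y @[y --> (0 : R)^'+] --> d ->
  complex.Im (z y * w y) / y @[y --> (0 : R)^'+] --> a * d + b * c.
Proof.
move=> za zb wc wd.
have -> : (fun y => complex.Im (z y * w y) / y) = (fun y =>
    complex.Re (z y) * (complex.Im (w y) / y) + complex.Im (z y) / y * complex.Re (w y)).
  by apply/funext => y; case: (z y) (w y) => [? ?] [? ?] /=; ring.
by apply: cvgD; apply: cvgM.
Qed.

Lemma enorm_divZ v : (enorm v / enorm v) *: v = v.
Proof.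
have [->|v0] := eqVneq v 0; first by rewrite scaler0.
by rewrite divff ?scale1r// enorm_eq0.
Qed.

(** Neither [rcosh y] nor [rsinh y] vanishes, so a zero would force [sin x = cos x = 0]. *)
Lemma csin_neq0 (x y : R) : y != 0 -> csin (x +i* y) != 0.
Proof.
move=> y0; rewrite csinE; apply/eqP => -[s0 c0].
have ch : rcosh y != 0 by rewrite gt_eqF// divr_gt0// addr_gt0// expR_gt0.
have sh : rsinh y != 0.
  rewrite mulf_neq0 ?invr_eq0 ?pnatr_eq0// subr_eq0; apply/eqP => /expR_inj yy.
  by move: y0; rewrite -oppr_eq0; move/eqP; apply; lra.
have := cos2Dsin2 x.
move/eqP: s0; rewrite mulf_eq0 (negbTE ch) orbF => /eqP ->.
move/eqP: c0; rewrite mulf_eq0 (negbTE sh) orbF => /eqP ->.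
by rewrite expr0n addr0 => /esym/eqP; rewrite oner_eq0.
Qed.

Lemma qpow_spline_slog q y : 0 < y < 2 ->
  qpow (spline_base (2 * y)) q = cexp (q.1%:C * slog y) *:
   ((qcos q.2 y, qsin q.2 y *: map_mx (real_complex R) q.2) : quat R[i]).
Proof.
move=> y02; have [z0 zE] := clog_spline_base y02.
by rewrite /qpow (negbTE z0) /cpowR zE.
Qed.

Lemma cexp_normsq (z : R[i]) :
  complex.Re (cexp z) ^+ 2 + complex.Im (cexp z) ^+ 2 = expR (complex.Re z) ^+ 2.
Proof.
case: z => a b /=; rewrite !mul0r subr0 addr0 !exprMn -mulrDr cos2Dsin2.
by rewrite mulr1.
Qed.

Lemma cexp_eq_re (z w : R[i]) : cexp z = cexp w -> complex.Re z = complex.Re w.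
Proof.
move=> zw; apply: expR_inj; apply/eqP.
rewrite -(@eqrXn2 _ 2)// ?expR_ge0//.
by rewrite -!cexp_normsq zw.
Qed.

Theorem qpowM_spline_inv q1 q2 q3 :
  (forall xi : R, qpow (spline_base xi) q1 * qpow (spline_base xi) q2 =
             qpow (spline_base xi) q3) ->
  q3 = q1 + q2 /\ cross3 q1.2 q2.2 = 0.
Proof.
move=> mulq.
have sc : q3.1 = q1.1 + q2.1.
  (* A point below 2 but above 1: then [sin y <= 1 < y], so the logarithm of the modulus is nonzero
     and can be cancelled. *)
  pose y : R := 3 / 2.
  have y02 : 0 < y < 2 by rewrite /y; lra.
  have [z0 zE] := clog_spline_base y02.
  pose L := clog (spline_base (2 * y)).
  have : cexp (q1.1%:C * L) ^+ 2 * cexp (q2.1%:C * L) ^+ 2 = cexp (q3.1%:C * L) ^+ 2.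
    by rewrite -!(qnorm_qpow _ z0) -qnormM mulq.
  (* Only moduli are compared, because [cexp] determines the imaginary part of its argument only
     modulo [2 pi]. *)
  rewrite !expr2 -!cexpD /L zE => /cexp_eq_re /=.
  have l0 : ln (sin y / y) < 0.
    have sy : 0 < sin y by rewrite sin2_gt0.
    apply: ln_lt0; apply/andP; split; first by rewrite divr_gt0//; lra.
    by rewrite ltr_pdivrMr ?mul1r; have := sin_le1 y; rewrite /y; lra.
  move: l0; set l := ln _; move: q1.1 q2.1 q3.1 => a1 a2 a3 l0.
  rewrite !mul0r !subr0 => H.
  have : (a1 + a2 - a3) * l = 0 by lra.
  by move=> /eqP; rewrite mulf_eq0 (lt_eqF l0) orbF subr_eq0 => /eqP ->.
(* With [a3 = a1 + a2] the scalar exponential factors cancel; this is coordinate [k] of the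
   remaining vector equation. *)
have veq y : 0 < y < 2 -> forall k,
    qcos q1.2 y * qsin q2.2 y * (q2.2 0 k)%:C +
    qcos q2.2 y * qsin q1.2 y * (q1.2 0 k)%:C +
    qsin q1.2 y * qsin q2.2 y * (cross3 q1.2 q2.2 0 k)%:C =
    qsin q3.2 y * (q3.2 0 k)%:C.
  move=> y02 k; have := mulq (2 * y).
  rewrite !qpow_spline_slog// qscaleM -cexpD -mulrDl -(rmorphD (real_complex R)) -sc.
  move=> /(scalerI (cexp_neq0 _)); rewrite qmulE /= => -[_ /rowP/(_ k)].
  by rewrite cross3Z cross3_cvec !mxE !mulrA.
have vsum : q3.2 = q1.2 + q2.2.
  apply/rowP => k.
  (* [G] and [H] are the imaginary parts of the two sides of [veq], divided by [y]. The cross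
     product term of [G] tends to 0 because the real part of [qsin] does. *)
  pose G y := complex.Im (qcos q1.2 y * qsin q2.2 y) / y * q2.2 0 k +
    complex.Im (qcos q2.2 y * qsin q1.2 y) / y * q1.2 0 k +
    complex.Im (qsin q1.2 y * qsin q2.2 y) / y * (cross3 q1.2 q2.2 0 k).
  pose H y := complex.Im (qsin q3.2 y) / y * q3.2 0 k.
  have GH : {near (0 : R)^'+, G =1 H}.
    near=> y.
    have y0 : 0 < y by [].
    have y2 : y < 2 by near: y; exact: nbhs_right_lt.
    have imC (z : R[i]) (c : R) : complex.Im (z * c%:C) = complex.Im z * c.
      by case: z => a b /=; ring.
    have imD (z w : R[i]) : complex.Im (z + w) = complex.Im z + complex.Im w.
      by case: z w => [? ?] [].
    have := congr1 (@complex.Im R) (veq y _ k); rewrite y0 y2 => /(_ isT).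
    rewrite !imD !imC /G /H => E; rewrite [RHS]mulrAC -E; ring.
  have cG : G y @[y --> (0 : R)^'+] -->
     (1 * - (enorm q2.2 / enorm q2.2) + 0 * 0) * q2.2 0 k +
     (1 * - (enorm q1.2 / enorm q1.2) + 0 * 0) * q1.2 0 k +
     (0 * - (enorm q2.2 / enorm q2.2) + - (enorm q1.2 / enorm q1.2) * 0) *
       (cross3 q1.2 q2.2 0 k).
    have cR := cvg_qcos_re; have cI := cvg_qcos_im.
    have sR := cvg_qsin_re; have sI := cvg_qsin_im.
    by apply: cvgD; first apply: cvgD; apply: cvgMl; apply: cvg_imM.
  have cH : H y @[y --> (0 : R)^'+] --> - (enorm q3.2 / enorm q3.2) * q3.2 0 k.
    by apply: cvgMl; exact: cvg_qsin_im.
  have := cvg_unique (@Rhausdorff R) (cvg_trans (near_eq_cvg GH) cG) cH.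
  have eE v : enorm v / enorm v * v 0 k = v 0 k.
    by have /rowP/(_ k) := enorm_divZ v; rewrite mxE.
  move=> lim_eq; rewrite mxE -(eE q1.2) -(eE q2.2) -(eE q3.2).
  have := lim_eq (fmap_proper_filter H (at_right_proper_filter 0)) _.
  rewrite !(mulr0, mul1r, mul0r, addr0, mulNr) => /(_ _) E.
  by apply: oppr_inj; rewrite -E opprD addrC.
split.
  by rewrite [LHS]surjective_pairing sc vsum.
set n := cross3 q1.2 q2.2.
have [//|n0] := eqVneq n 0.
(* One point suffices from here on: [slog 1] has imaginary part -1, so [qsin v 1] is nonzero for
   every nonzero [v]. *)
have y02 : 0 < (1 : R) < 2 by lra.
have qs v : v != 0 -> qsin v 1 != 0.
  move=> v0; have e0 : enorm v != 0 by rewrite enorm_eq0.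
  rewrite /qsin mulf_neq0 ?invr_eq0 ?fmorph_eq0// slog_scale csin_neq0//.
  by rewrite oppr_eq0 mulf_neq0// oner_eq0.
have v10 : q1.2 != 0.
  by apply: contraNneq n0 => v0; rewrite /n v0; apply/eqP/rowP => i; rewrite !mxE; ring.
have v20 : q2.2 != 0.
  by apply: contraNneq n0 => v0; rewrite /n v0; apply/eqP/rowP => i; rewrite !mxE; ring.
have := veq 1 y02; rewrite -/n vsum => E.
(* This is the dot product of [veq] with [n]: [v1], [v2] and [v3 = v1 + v2] are orthogonal to [n],
   so only the cross product term survives. *)
suff : qsin q1.2 1 * qsin q2.2 1 * (dot3 n n)%:C = 0.
  move=> nn0; have s12 := mulf_neq0 (qs _ v10) (qs _ v20).
  have /eqP := mulfI s12 (etrans nn0 (esym (mulr0 _))).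
  by rewrite fmorph_eq0 => /eqP /dot3_eq0.
have n1 : dot3 n q1.2 = 0 by rewrite dot3E !mxE !ord3E; ring.
have n2 : dot3 n q2.2 = 0 by rewrite dot3E !mxE !ord3E; ring.
have := (E 0, E 1, E 2) => -[[E0 E1] E2].
have : (n 0 0)%:C * (qsin (q1.2 + q2.2) 1 * ((q1.2 + q2.2) 0 0)%:C) +
  (n 0 1)%:C * (qsin (q1.2 + q2.2) 1 * ((q1.2 + q2.2) 0 1)%:C) +
  (n 0 2)%:C * (qsin (q1.2 + q2.2) 1 * ((q1.2 + q2.2) 0 2)%:C) = 0.
  transitivity (qsin (q1.2 + q2.2) 1 * (dot3 n q1.2 + dot3 n q2.2)%:C).
    rewrite !dot3E !mxE !(rmorphD (real_complex R)) !(rmorphM (real_complex R)) /=.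
    ring.
  by rewrite n1 n2 addr0 mulr0.
rewrite -E0 -E1 -E2 => <-.
transitivity (qsin q1.2 1 * qsin q2.2 1 * (dot3 n n)%:C +
  qcos q1.2 1 * qsin q2.2 1 * (dot3 n q2.2)%:C +
  qcos q2.2 1 * qsin q1.2 1 * (dot3 n q1.2)%:C).
  by rewrite n1 n2 !mulr0 !addr0.
rewrite !dot3E !(rmorphD (real_complex R)) !(rmorphM (real_complex R)) /=.
ring.
Unshelve. all: by end_near. Qed.

End Forward.

(** * Quaternionic Fourier transform *)

Section QuaternionFourier.
Variable R : realType.
Notation mu := (@lebesgue_measure R).
Implicit Types (f g : R -> R[i]) (A B : R -> quat R[i]).

Lemma cfourierD f g xi : cintegrable f -> cintegrable g ->
  cfourier (fun x => f x + g x) xi = cfourier f xi + cfourier g xi.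
Proof.
move=> cf cg; rewrite /cfourier -cintD; try exact: cintegrable_phase.
by apply: eq_cint => x; rewrite mulrDr.
Qed.

Lemma cfourierB f g xi : cintegrable f -> cintegrable g ->
  cfourier (fun x => f x - g x) xi = cfourier f xi - cfourier g xi.
Proof.
move=> cf cg; rewrite /cfourier -cintB; try exact: cintegrable_phase.
by apply: eq_cint => x; rewrite mulrBr.
Qed.

Lemma ae_eq_cfourier f g xi : cintegrable f -> cintegrable g ->
  {ae mu, forall x, f x = g x} -> cfourier f xi = cfourier g xi.
Proof.
move=> cf cg fg; apply: ae_eq_cint; try exact: cintegrable_phase.
by apply: ae_imp fg => x ->.
Qed.

Lemma eq_cfourier_ae f g : cintegrable f -> cintegrable g ->
  (forall xi, cfourier f xi = cfourier g xi) -> {ae mu, forall x, f x = g x}.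
Proof.
move=> cf cg fg; have cfg := cintegrableB cf cg.
have /(cfourier_inj cfg) : forall xi, cfourier (fun x => f x - g x) xi = 0.
  by move=> xi; rewrite cfourierB// fg subrr.
by apply: ae_imp => x /eqP; rewrite subr_eq0 => /eqP.
Qed.

Lemma fourierE B xi : fourier B xi =
  (cfourier (fun x => (B x).1) xi, \row_k cfourier (fun x => (B x).2 0 k) xi).
Proof.
rewrite /fourier /qint; congr pair; apply/rowP => k; rewrite !mxE.
by apply: eq_cint => x; rewrite mxE.
Qed.

Lemma ae_ord3 (P : 'I_3 -> R -> Prop) :
  (forall k, {ae mu, forall x, P k x}) -> {ae mu, forall x, forall k, P k x}.
Proof.
move=> aeP; apply: ae_imp (ae_and (ae_and (aeP 0) (aeP 1)) (aeP 2)).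
by move=> x [[P0 P1] P2]; exact: ord3P.
Qed.

Lemma ae_eq_qcomponents A B : {ae mu, forall x, (A x).1 = (B x).1} ->
  (forall k, {ae mu, forall x, (A x).2 0 k = (B x).2 0 k}) ->
  {ae mu, forall x, A x = B x}.
Proof.
move=> A1 /ae_ord3 A2; apply: ae_imp (ae_and A1 A2) => x [e1 e2].
by rewrite (surjective_pairing (A x)) (surjective_pairing (B x)) e1;
  congr pair; apply/rowP.
Qed.

Lemma ae_eq_fourier A B xi : qintegrable A -> qintegrable B ->
  {ae mu, forall x, A x = B x} -> fourier A xi = fourier B xi.
Proof.
move=> [A1 A2] [B1 B2] AB; rewrite !fourierE; congr pair.
  by apply: ae_eq_cfourier => //; apply: ae_imp AB => x ->.
apply/rowP => k; rewrite !mxE.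
by apply: ae_eq_cfourier => //; apply: ae_imp AB => x ->.
Qed.

Theorem fourier_inj A B : qintegrable A -> qintegrable B ->
  (forall xi, fourier A xi = fourier B xi) -> {ae mu, forall x, A x = B x}.
Proof.
move=> [A1 A2] [B1 B2] AB; apply: ae_eq_qcomponents => [|k].
  by apply: eq_cfourier_ae => // xi; have := congr1 fst (AB xi); rewrite !fourierE.
apply: eq_cfourier_ae => // xi; have := congr1 snd (AB xi).
by rewrite !fourierE => /rowP/(_ k); rewrite !mxE.
Qed.

(* [P] represents in L^1 the function [t |-> cint (k t)], and [F] is its
   Fourier transform. *)
Definition conv_repr (k : R -> R -> R[i]) (F : R -> R[i]) (P : R -> R[i]) :=
  [/\ cintegrable P, {ae mu, forall t, cintegrable (k t) /\ cint (k t) = P t} &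
      forall xi, cfourier P xi = F xi].

Lemma eq_conv_repr k l F G : (forall t x, k t x = l t x) -> F =1 G ->
  (exists P, conv_repr k F P) -> exists P, conv_repr l G P.
Proof.
move=> kl /funext<-; suff -> : k = l by [].
by apply/funext => t; apply/funext => x.
Qed.

Lemma conv_reprM f g : cintegrable f -> cintegrable g ->
  exists P, conv_repr (fun t x => f x * g (t - x))
    (fun xi => cfourier f xi * cfourier g xi) P.
Proof.
move=> cf cg; exists (cconv f g); split; first exact: cintegrable_cconv.
  by apply: ae_imp (ae_cintegrable_cconv cf cg).
by move=> xi; exact: cfourier_cconv.
Qed.

Lemma conv_reprD k l F G : (exists P, conv_repr k F P) ->
  (exists P, conv_repr l G P) ->
  exists P, conv_repr (fun t x => k t x + l t x) (fun xi => F xi + G xi) P.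
Proof.
move=> [P [cP kP FP]] [Q [cQ lQ GQ]]; exists (fun t => P t + Q t); split.
- exact: cintegrableD.
- apply: ae_imp (ae_and kP lQ) => t [[ck <-] [cl <-]].
  by split; [exact: cintegrableD|rewrite cintD].
- by move=> xi; rewrite cfourierD// FP GQ.
Qed.

Lemma conv_reprB k l F G : (exists P, conv_repr k F P) ->
  (exists P, conv_repr l G P) ->
  exists P, conv_repr (fun t x => k t x - l t x) (fun xi => F xi - G xi) P.
Proof.
move=> [P [cP kP FP]] [Q [cQ lQ GQ]]; exists (fun t => P t - Q t); split.
- exact: cintegrableB.
- apply: ae_imp (ae_and kP lQ) => t [[ck <-] [cl <-]].
  by split; [exact: cintegrableB|rewrite cintB].
- by move=> xi; rewrite cfourierB// FP GQ.
Qed.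

(** Each coordinate of the Hamilton product is a sum or difference of scalar convolutions. Splitting
    the integral is justified where every section is integrable, so an integrable representative [P]
    equal to [qconv A B] almost everywhere is provided. *)
Theorem fourier_qconv A B : qintegrable A -> qintegrable B ->
  exists P, [/\ qintegrable P, {ae mu, forall t, qconv A B t = P t} &
    forall xi, fourier P xi = fourier A xi * fourier B xi].
Proof.
move=> [A0 Av] [B0 Bv].
have [P0 [cP0 aeP0 FP0]] : exists P, conv_repr (fun t x => (A x * B (t - x)).1)
    (fun xi => (fourier A xi * fourier B xi).1) P.
  have := conv_reprB (conv_reprM A0 B0) (conv_reprD (conv_reprD
    (conv_reprM (Av 0) (Bv 0)) (conv_reprM (Av 1) (Bv 1)))
    (conv_reprM (Av 2) (Bv 2))).
  apply: eq_conv_repr => [t x|xi]; first by rewrite qmulE /= dot3E.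
  by rewrite qmulE !fourierE /= dot3E !mxE.
have /choice[Pv Pvk] : forall k, exists P,
    conv_repr (fun t x => (A x * B (t - x)).2 0 k)
      (fun xi => (fourier A xi * fourier B xi).2 0 k) P.
  move=> k; have := conv_reprD (conv_reprD (conv_reprM A0 (Bv k))
    (conv_reprM (Av k) B0)) (conv_reprB
    (conv_reprM (Av (k + 1)) (Bv (k + 2))) (conv_reprM (Av (k + 2)) (Bv (k + 1)))).
  apply: eq_conv_repr => [t x|xi].
    (* In the term [q.1 *: p.2] of the product the coordinate of [B] comes first; the coordinates
       commute. *)
    by rewrite qmulE /= !mxE; congr (_ + _ + _); rewrite mulrC.
  rewrite qmulE !fourierE /= !mxE.
  by congr (_ + _ + _); rewrite mulrC.
exists (fun t => (P0 t, \row_k Pv k t)); split.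
- split=> //= k; have [cP _ _] := Pvk k.
  by apply: eq_cintegrable cP => x; rewrite mxE.
- apply: ae_eq_qcomponents => [|k].
    by apply: ae_imp aeP0 => t [].
  have [_ aeP _] := Pvk k.
  by apply: ae_imp aeP => t [_ eP]; rewrite !mxE.
- move=> xi; rewrite [LHS]fourierE [RHS]surjective_pairing; congr pair.
    exact: FP0.
  apply/rowP => k; have [_ _ <-] := Pvk k; rewrite mxE.
  by apply: eq_cint => x; rewrite mxE.
Qed.

End QuaternionFourier.

Theorem proposition3 (R : realType) (q1 q2 q3 : quat R)
    (B1 B2 B3 : R -> quat (complex R))
    (ha1 : 1 < Sc q1) (ha2 : 1 < Sc q2) (ha3 : 1 < Sc q3)
    (hB1 : is_qBspline q1 B1) (hB2 : is_qBspline q2 B2)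
    (hB3 : is_qBspline q3 B3) :
  {ae @lebesgue_measure R, forall t, qconv B1 B2 t = B3 t} <->
  (q3 = q1 + q2 /\ ~~ free [:: Ve q1; Ve q2]).
Proof.
have [[iB1 F1] [iB2 F2] [iB3 F3]] := And3 hB1 hB2 hB3.
have [P [iP convP FP]] := fourier_qconv iB1 iB2.
split=> [convB3|[q3E dep]].
  have [] := @qpowM_spline_inv R q1 q2 q3.
    move=> xi; rewrite -F1 -F2 -F3 -FP; apply: ae_eq_fourier => //.
    by apply: ae_imp (ae_and convP convB3) => t [<- <-].
  by move=> -> cross0; split => //; exact: cross3_eq0_dep.
have PB3 : {ae @lebesgue_measure R, forall t, P t = B3 t}.
  (* By linear dependence the powers multiply, so [P] and [B3] have the same Fourier transform. *)
  by apply: fourier_inj => // xi; rewrite FP F1 F2 F3 q3E qpowM.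
by apply: ae_imp (ae_and convP PB3) => t [-> ->].
Qed.
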